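(* Let $\mathcal{F}_2$ be the field of (locally) analytic functions $f(x,y)$ of two variables, and let $\mathcal{F}_2[X,Y]$ be the ring of linear partial differential operators with coefficients in $\mathcal{F}_2$, where $X=\partial/\partial x$, $Y=\partial/\partial y$. Let $u\in\mathcal{F}_2$ and $H=-XY+u\in\mathcal{F}_2[X,Y]$. Suppose $L_1,L_2\in\mathcal{F}_2[X,Y]$ satisfy $$[L_1,L_2]=P_0\cdot H,\qquad [L_1,H]=P_1\cdot H,\qquad [L_2,H]=P_2\cdot H$$ for some $P_0,P_1,P_2\in\mathcal{F}_2[X,Y]$, where $[A,B]=A\cdot B-B\cdot A$. Then there exists a nonzero polynomial $Q(s,t)$ in two commuting variables with constant coefficients such that $Q(L_1,L_2)=S\cdot H$ for some $S\in\mathcal{F}_2[X,Y]$.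
   Context: Products of operators denote composition. Since $L_1$ and $L_2$ need not commute exactly, $Q(L_1,L_2)$ is understood with each monomial written in the fixed order $L_1^rL_2^s$, i.e. $Q(L_1,L_2)=\sum_{r,s} b_{r,s}L_1^rL_2^s$ with constants $b_{r,s}$. *)

(* Defs.v *)
From HB Require Import structures.
From mathcomp Require Import all_boot all_order all_algebra.
From mathcomp Require Import all_classical all_reals all_analysis.
From mathcomp Require Import complex.

Set Implicit Arguments.
Unset Strict Implicit.
Unset Printing Implicit Defensive.

Import Order.TTheory GRing.Theory Num.Theory.
Import numFieldTopology.Exports numFieldNormedType.Exports.
Local Open Scope classical_set_scope.
Local Open Scope ring_scope.

(* Equip the complex numbers R[i] with their standard (norm) topology. *)
HB.instance Definition _ (R : rcfType) := PseudoPointedMetric.copy R[i] (R[i])^o.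

Notation CC R := (complex R).
Notation C2 R := (complex R * complex R)%type.

Section Defs.
Variable R : realType.

Local Notation CC := (complex R).
Local Notation C2 := (complex R * complex R)%type.

Definition analytic_on (U : set C2) (f : C2 -> CC) : Prop :=
  forall p, U p -> exists r : CC, 0 < r /\ exists a : nat -> nat -> CC,
    forall z : C2, `|z.1 - p.1| < r -> `|z.2 - p.2| < r ->
      (exists M : CC, forall n : nat,
         \sum_(i < n) \sum_(j < n) `|a i j| * `|z.1 - p.1| ^+ i * `|z.2 - p.2| ^+ j
         <= M) /\
      ((fun n : nat => \sum_(i < n) \sum_(j < n)
                        a i j * (z.1 - p.1) ^+ i * (z.2 - p.2) ^+ j)
         @ \oo --> (f z : CC)).

Definition dX (f : C2 -> CC) : C2 -> CC := fun z =>
  lim ((fun h : CC => (f (z.1 + h, z.2) - f z) / h) @ (0 : CC)^').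
Definition dY (f : C2 -> CC) : C2 -> CC := fun z =>
  lim ((fun h : CC => (f (z.1, z.2 + h) - f z) / h) @ (0 : CC)^').

(* A linear partial differential operator  sum_{i,j <= ord} coef i j X^i Y^j. *)
Record diffop := DiffOp { ord : nat; coef : nat -> nat -> C2 -> CC }.

Definition act (L : diffop) (f : C2 -> CC) : C2 -> CC := fun z =>
  \sum_(i < (ord L).+1) \sum_(j < (ord L).+1)
     coef L i j z * iter i dX (iter j dY f) z.

Definition diffop_on (U : set C2) (L : diffop) : Prop :=
  forall i j, (i <= ord L)%N -> (j <= ord L)%N -> analytic_on U (coef L i j).

Definition Hop (u : C2 -> CC) : diffop :=
  DiffOp 1 (fun i j => if (i == 1%N) && (j == 1%N) then (fun _ => -1)
                       else if (i == 0%N) && (j == 0%N) then u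
                       else (fun _ => 0)).

Definition op_eq (U : set C2) (A B : (C2 -> CC) -> (C2 -> CC)) : Prop :=
  forall f, analytic_on U f -> forall z, U z -> A f z = B f z.

Definition op_comp (A B : (C2 -> CC) -> (C2 -> CC)) := fun f => A (B f).
Definition op_comm (A B : (C2 -> CC) -> (C2 -> CC)) :=
  fun f z => A (B f) z - B (A f) z.

(* For Q(s,t) = sum_{r,s} b_{r,s} s^r t^s, encoded as Q : {poly {poly CC}}
   with b_{r,s} = (Q`_r)`_s, the operator Q(L1,L2) = sum b_{r,s} L1^r L2^s. *)
Definition poly_act (Q : {poly {poly CC}}) (A B : (C2 -> CC) -> (C2 -> CC)) :=
  fun f z => \sum_(r < size Q) \sum_(s < size Q`_r)
               (Q`_r)`_s * iter r A (iter s B f) z.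

End Defs.

(* Main.v *)
(* Modulo the left ideal D H, where X Y = u - H, every operator is congruent to
   one without mixed terms, A(X) + B(Y).  If E is such an operator normalising
   D H and commuting with L modulo D H, then the leading X-coefficient e of E
   depends on x only and satisfies n l e' = k e l', where l is the leading
   X-coefficient of L, so e is determined by its value at a point where l does
   not vanish; likewise for Y.  Hence a combination of the monomials
   L1^r L2^s whose reduced coefficients all vanish at one well-chosen point has
   reduced form zero near that point.  For r, s < K there are K^2 monomials but
   only O(K) coefficients, so a nonzero such combination exists. *)

Require Import Defs.
From HB Require Import structures.
From mathcomp Require Import all_boot all_order all_algebra.
From mathcomp Require Import all_classical all_reals all_analysis.
From mathcomp Require Import complex.
From mathcomp Require Import ring zify.
Import Order.TTheory GRing.Theory Num.Theory.
Import numFieldTopology.Exports numFieldNormedType.Exports.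
Set Implicit Arguments.
Unset Strict Implicit.
Unset Printing Implicit Defensive.
Local Open Scope classical_set_scope.
Local Open Scope ring_scope.

(** * Differential operators as symbols *)

(** The functions analytic on a possibly disconnected open set form a ring with zero divisors, and a
    leading coefficient may vanish identically on one component only. Degrees are therefore read at
    a base point: a coefficient counts as zero when it is flat, that is, when all its derivatives
    vanish there, which for an analytic function means that it vanishes near the point. Both
    equations for a leading coefficient come from one fact: if the rows above [X^m] of a left
    multiple of H are flat, so is its coefficient of the pure power [X^m]. For E of X-degree k with
    leading X-coefficient e, that of [[E, H]] at [X^(k+1)] is the y-derivative of e; for L of
    X-degree n, that of [[L, E]] at [X^(n+k-1)] is [n l e' - k e l'], the degree [n + k] having
    cancelled. If neither reduced operator has positive X-degree there is no equation to use, but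
    then every combination has X-degree 0, and its reduced form inherits this. *)

Record biderivation (A : comNzRingType) := Biderivation {
  bdx : {additive A -> A};
  bdy : {additive A -> A};
  bdxM : forall f g, bdx (f * g) = bdx f * g + f * bdx g;
  bdyM : forall f g, bdy (f * g) = bdy f * g + f * bdy g;
  bdxyC : forall f, bdx (bdy f) = bdy (bdx f) }.

(** Exchanging the derivations turns each result on leading X-coefficients into one on leading
    Y-coefficients, so only the former are proved. *)
Definition biderivation_swap (A : comNzRingType) (d : biderivation A) :=
  Biderivation (bdyM d) (bdxM d) (fun f => esym (bdxyC d f)).

(* A polynomial stands for the operator with the same coefficients: the outer
   variable is X, the inner one is Y, and coefficients are written on the left. *)
Definition symb (A : comNzRingType) (d : biderivation A) := {poly {poly A}}.

Section Action.
Variables (A : comNzRingType) (d : biderivation A).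
Local Notation D := (symb d).
(** Only the additive group is inherited from polynomials. The alias carries [d] so that
    composition, which depends on it, can become its product. *)
HB.instance Definition _ := GRing.Zmodule.on D.
Local Notation dx := (bdx d).
Local Notation dy := (bdy d).
Implicit Types (p q : D) (f g : A).

Lemma bdx1 : dx 1 = 0.
Proof. by apply: (addrI (dx 1)); have := bdxM d 1 1; rewrite !mulr1 mul1r addr0. Qed.
Lemma bdy1 : dy 1 = 0.
Proof. by apply: (addrI (dy 1)); have := bdyM d 1 1; rewrite !mulr1 mul1r addr0. Qed.

Definition co p (i j : nat) : A := (p : {poly {poly A}})`_i`_j.

Lemma coP p q : (forall i j, co p i j = co q i j) -> p = q.
Proof. by move=> e; apply/polyP => i; apply/polyP => j; exact: e. Qed.

Lemma coD p q i j : co (p + q) i j = co p i j + co q i j.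
Proof. by rewrite /co !coefD. Qed.
Lemma coN p i j : co (- p) i j = - co p i j.
Proof. by rewrite /co !coefN. Qed.
Lemma coB p q i j : co (p - q) i j = co p i j - co q i j.
Proof. by rewrite coD coN. Qed.
Lemma co0 i j : co 0 i j = 0.
Proof. by rewrite /co !coef0. Qed.
Lemma co_sum I r (P : pred I) (F : I -> D) i j :
  co (\sum_(k <- r | P k) F k) i j = \sum_(k <- r | P k) co (F k) i j.
Proof. by rewrite /co !coef_sum. Qed.

(* [scal f], [multX], [multY] are left composition with f, X and Y. *)
Definition scal f p : D := map_poly ( *%R f%:P) p.
Definition multX p : D := map_poly (map_poly dx) p + (p : {poly {poly A}}) * 'X.
Definition multY p : D := map_poly (fun c => map_poly dy c + c * 'X) p.

Lemma co_scal f p i j : co (scal f p) i j = f * co p i j.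
Proof. by rewrite /co /scal coef_map_id0 ?mulr0 // coefCM. Qed.
Lemma co_multX p i j :
  co (multX p) i j = dx (co p i j) + (if i is i'.+1 then co p i' j else 0).
Proof.
rewrite /co /multX coefD coefMX coef_map_id0 ?rmorph0 ?map_poly0 //.
by rewrite coefD coef_map /=; case: i => [|i] //=; rewrite coef0.
Qed.
Lemma co_multY p i j :
  co (multY p) i j = dy (co p i j) + (if j is j'.+1 then co p i j' else 0).
Proof.
rewrite /co /multY coef_map_id0 ?map_poly0 ?mul0r ?addr0 //.
by rewrite coefD coefMX coef_map /=; case: j.
Qed.

Definition bound N p := forall i j, (N <= i)%N || (N <= j)%N -> co p i j = 0.

Lemma bound_exists p : exists N, bound N p.
Proof.
exists (maxn (size (p : {poly {poly A}})) (\max_(i < size (p : {poly {poly A}})) size ((p : {poly {poly A}})`_i)%R)).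
move=> i j; rewrite /co !geq_max; case: (leqP (size (p : {poly {poly A}})) i) => [ip _|ip].
  by have -> : (p : {poly {poly A}})`_i = 0 by [exact: nth_default]; rewrite coef0.
rewrite /= => /andP[_ h]; apply: nth_default; apply: leq_trans h.
by rewrite (leq_bigmax (F := fun i : 'I__ => size ((p : {poly {poly A}})`_i)%R) (Ordinal ip)).
Qed.

Lemma boundW N M p : (N <= M)%N -> bound N p -> bound M p.
Proof.
by move=> le h i j /orP[] l; apply: h; rewrite (leq_trans le l) ?orbT.
Qed.

Section Module.
Variables (V : zmodType) (sc : A -> V -> V) (DX DY : {additive V -> V}).
Hypothesis scDl : forall f g v, sc (f + g) v = sc f v + sc g v.
Hypothesis scDr : forall f v w, sc f (v + w) = sc f v + sc f w.
Hypothesis scA : forall f g v, sc (f * g) v = sc f (sc g v).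
Hypothesis DXsc : forall f v, DX (sc f v) = sc (dx f) v + sc f (DX v).
Hypothesis DYsc : forall f v, DY (sc f v) = sc (dy f) v + sc f (DY v).
Hypothesis DXY : forall v, DX (DY v) = DY (DX v).

(** One action serves twice: with [V] the symbols it is composition, with [V] a space of functions
    it is application. Associativity and compatibility with application are then the same lemma,
    [pact_smul]. *)
Definition pact p v : V :=
  \sum_(i < size (p : {poly {poly A}})) \sum_(j < size ((p : {poly {poly A}})`_i)%R)
     sc (co p i j) (iter i DX (iter j DY v)).

Lemma sc0l v : sc 0 v = 0.
Proof. by apply: (addrI (sc 0 v)); rewrite -scDl !addr0. Qed.
Lemma sc0r f : sc f 0 = 0.
Proof. by apply: (addrI (sc f 0)); rewrite -scDr !addr0. Qed.
Lemma sc_sumr f I r (P : pred I) (F : I -> V) :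
  sc f (\sum_(k <- r | P k) F k) = \sum_(k <- r | P k) sc f (F k).
Proof. by apply: (big_morph _ (scDr f) (sc0r f)). Qed.

Lemma pactE N p v : bound N p ->
  pact p v = \sum_(i < N) \sum_(j < N) sc (co p i j) (iter i DX (iter j DY v)).
Proof.
move=> b; rewrite /pact.
have key (n : nat) (F : nat -> V) : (forall i, (n <= i)%N -> F i = 0) ->
    (forall i, (N <= i)%N -> F i = 0) -> \sum_(i < n) F i = \sum_(i < N) F i.
  move=> h1 h2; wlog le : n N h1 h2 {b} / (n <= N)%N => [hw|].
    by case/orP: (leq_total n N) => l; [exact: hw | apply/esym; exact: hw].
  rewrite (big_ord_widen _ F le) big_mkcond /=.
  by apply: eq_bigr => i _; case: ltnP => // /h1.
rewrite (key _ (fun i => \sum_(j < size ((p : {poly {poly A}})`_i)%R)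
     sc (co p i j) (iter i DX (iter j DY v)))).
- apply: eq_bigr => i _; apply: (key _ (fun j => sc (co p i j) (iter i DX (iter j DY v)))) => j l; last by rewrite b ?l ?orbT // sc0l.
  by rewrite /co nth_default // sc0l.
- by move=> i l; rewrite nth_default // size_poly0 big_ord0.
- by move=> i l; apply: big1 => j _; rewrite b ?l // sc0l.
Qed.

Lemma pactDl p q v : pact (p + q) v = pact p v + pact q v.
Proof.
have [N1 b1] := bound_exists p; have [N2 b2] := bound_exists q.
pose N := maxn N1 N2.
have c1 : bound N p by apply: boundW b1; exact: leq_maxl.
have c2 : bound N q by apply: boundW b2; exact: leq_maxr.
have c3 : bound N (p + q) by move=> i j l; rewrite coD c1 // c2 // addr0.
rewrite !(pactE v (N := N)) // -big_split; apply: eq_bigr => i _.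
by rewrite -big_split; apply: eq_bigr => j _; rewrite coD scDl.
Qed.

Lemma iterD_add (T : {additive V -> V}) n v w : iter n T (v + w) = iter n T v + iter n T w.
Proof. by elim: n => //= n ->; rewrite raddfD. Qed.

Lemma pactDr p v w : pact p (v + w) = pact p v + pact p w.
Proof.
rewrite /pact -big_split; apply: eq_bigr => i _.
by rewrite -big_split; apply: eq_bigr => j _; rewrite !iterD_add scDr.
Qed.

Lemma pact0l v : pact 0 v = 0.
Proof. by apply: (addrI (pact 0 v)); rewrite -pactDl !addr0. Qed.
Lemma pact_suml I r (P : pred I) (F : I -> D) v :
  pact (\sum_(k <- r | P k) F k) v = \sum_(k <- r | P k) pact (F k) v.
Proof. by apply: (big_morph (pact^~ v) (fun p q => pactDl p q v) (pact0l v)). Qed.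

Lemma pact_scal f p v : pact (scal f p) v = sc f (pact p v).
Proof.
have [N b] := bound_exists p.
have c : bound N (scal f p) by move=> i j l; rewrite co_scal b // mulr0.
rewrite !(pactE v (N := N)) // sc_sumr; apply: eq_bigr => i _.
by rewrite sc_sumr; apply: eq_bigr => j _; rewrite co_scal scA.
Qed.

(** Leibniz splits each term into one with a differentiated coefficient and one with an extra X. The
    latter is the index shift of [multX], for which the bound [N.+1] leaves room. *)
Lemma pact_multX p v : pact (multX p) v = DX (pact p v).
Proof.
have [N b] := bound_exists p.
have b1 := boundW (leqnSn N) b.
have c : bound N.+1 (multX p).
  move=> i j l; rewrite co_multX b1 // raddf0 add0r; case: i l => // i l.
  by apply: b; case/orP: l => l; [rewrite -ltnS l | rewrite (ltnW l) orbT].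
rewrite (pactE v c) (pactE v b1) raddf_sum.
under eq_bigr => i _ do under eq_bigr => j _ do rewrite co_multX scDl.
under eq_bigr => i _ do rewrite big_split.
rewrite big_split /= addrC.
under [RHS]eq_bigr => i _ do (rewrite raddf_sum; under eq_bigr => j _ do rewrite DXsc).
under [RHS]eq_bigr => i _ do rewrite big_split.
rewrite [RHS]big_split [RHS]addrC; congr (_ + _).
rewrite big_ord_recl big1 ?add0r => [|j _]; last by rewrite sc0l.
rewrite [RHS]big_ord_recr /= [X in _ + X]big1 ?addr0 => [|j _]; last first.
  by rewrite b ?leqnn // sc0l.
by apply: eq_bigr.
Qed.

Lemma DY_iterDX j v : DY (iter j DX v) = iter j DX (DY v).
Proof. by elim: j => //= j <-; rewrite DXY. Qed.

Lemma pact_multY p v : pact (multY p) v = DY (pact p v).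
Proof.
have [N b] := bound_exists p.
have b1 := boundW (leqnSn N) b.
have c : bound N.+1 (multY p).
  move=> i j l; rewrite co_multY b1 // raddf0 add0r; case: j l => // j l.
  by apply: b; case/orP: l => l; [rewrite (ltnW l) | rewrite orbC -ltnS l].
rewrite (pactE v c) (pactE v b1) raddf_sum; apply: eq_bigr => i _.
under eq_bigr => j _ do rewrite co_multY scDl.
rewrite big_split /= addrC raddf_sum.
under [RHS]eq_bigr => j _ do rewrite DYsc.
rewrite [RHS]big_split [RHS]addrC; congr (_ + _).
rewrite big_ord_recl sc0l add0r.
rewrite [RHS]big_ord_recr /= b ?leqnn ?orbT // sc0l addr0.
by apply: eq_bigr => j _; rewrite DY_iterDX.
Qed.
End Module.

Lemma multX_add : additive multX.
Proof.
move=> p q; apply: coP => i j; rewrite coB !co_multX coB raddfB.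
by case: i => [|i]; rewrite ?addr0 // coB opprD addrACA.
Qed.
Lemma multY_add : additive multY.
Proof.
move=> p q; apply: coP => i j; rewrite coB !co_multY coB raddfB.
by case: j => [|j]; rewrite ?addr0 // coB opprD addrACA.
Qed.
HB.instance Definition _ := GRing.isZmodMorphism.Build D D multX multX_add.
HB.instance Definition _ := GRing.isZmodMorphism.Build D D multY multY_add.

Lemma scalDl f g p : scal (f + g) p = scal f p + scal g p.
Proof. by apply: coP => i j; rewrite coD !co_scal mulrDl. Qed.
Lemma scalDr f p q : scal f (p + q) = scal f p + scal f q.
Proof. by apply: coP => i j; rewrite coD !co_scal coD mulrDr. Qed.
Lemma scalA f g p : scal (f * g) p = scal f (scal g p).
Proof. by apply: coP => i j; rewrite !co_scal mulrA. Qed.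
Lemma multX_scal f p : multX (scal f p) = scal (dx f) p + scal f (multX p).
Proof.
apply: coP => i j; rewrite coD co_multX !co_scal co_multX bdxM mulrDr addrA.
by case: i => [|i]; rewrite ?mulr0 ?co_scal.
Qed.
Lemma multY_scal f p : multY (scal f p) = scal (dy f) p + scal f (multY p).
Proof.
apply: coP => i j; rewrite coD co_multY !co_scal co_multY bdyM mulrDr addrA.
by case: j => [|j]; rewrite ?mulr0 ?co_scal.
Qed.
Lemma multXY p : multX (multY p) = multY (multX p).
Proof.
apply: coP => i j; rewrite co_multX !co_multY !co_multX !raddfD bdxyC -!addrA.
congr (_ + _); case: i => [|i]; case: j => [|j] /=; rewrite ?co_multY ?co_multX ?addr0 ?raddf0 ?add0r //.
by rewrite addrCA.
Qed.

Definition smul p q : D := pact scal multX multY p q.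

(** [scal], [multX] and [multY] intertwine with [sc], [DX] and [DY], so expanding the left factor
    alone is enough. *)
Lemma pact_smul (V : zmodType) (sc : A -> V -> V) (DX DY : {additive V -> V}) :
  (forall f g v, sc (f + g) v = sc f v + sc g v) ->
  (forall f v w, sc f (v + w) = sc f v + sc f w) ->
  (forall f g v, sc (f * g) v = sc f (sc g v)) ->
  (forall f v, DX (sc f v) = sc (dx f) v + sc f (DX v)) ->
  (forall f v, DY (sc f v) = sc (dy f) v + sc f (DY v)) ->
  (forall v, DX (DY v) = DY (DX v)) ->
  forall p q v, pact sc DX DY (smul p q) v = pact sc DX DY p (pact sc DX DY q v).
Proof.
move=> h1 h2 h3 h4 h5 h6 p q v.
have key a b : pact sc DX DY (iter a multX (iter b multY q)) v =
               iter a DX (iter b DY (pact sc DX DY q v)).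
  elim: a => [|a IH] /=; last by rewrite pact_multX // IH.
  by elim: b => [|b IH] //=; rewrite pact_multY // IH.
rewrite [RHS]/pact [smul p q]/smul [X in pact _ _ _ X v]/pact pact_suml //.
apply: eq_bigr => i _; rewrite pact_suml //; apply: eq_bigr => j _.
by rewrite pact_scal // key.
Qed.

Definition mono f i j : D := (f *: 'X^j) *: 'X^i.
Lemma co_mono f i j k l : co (mono f i j) k l = if (k == i) && (l == j) then f else 0.
Proof.
rewrite /co /mono coefZ coefXn; case: eqP => _; rewrite ?mulr0 ?coef0 // mulr1.
by rewrite coefZ coefXn; case: eqP => _; rewrite ?mulr1 ?mulr0.
Qed.
Definition sone : D := mono 1 0 0.

Lemma iter_multX_mono f i j k : dx f = 0 -> iter k multX (mono f i j) = mono f (k + i) j.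
Proof.
move=> f0; elim: k => //= k ->; apply: coP => a b.
rewrite co_multX !co_mono; case: ifP => _; rewrite ?f0 ?raddf0 add0r.
  by case: a => //= a; rewrite co_mono.
by case: a => //= a; rewrite co_mono.
Qed.
Lemma iter_multY_mono f i j k : dy f = 0 -> iter k multY (mono f i j) = mono f i (k + j).
Proof.
move=> f0; elim: k => //= k ->; apply: coP => a b.
rewrite co_multY !co_mono; case: ifP => _; rewrite ?f0 ?raddf0 add0r.
  by case: b => [|b] //=; rewrite ?andbF ?co_mono.
by case: b => [|b] //=; rewrite ?andbF ?co_mono.
Qed.

Lemma symbE N p : bound N p -> p = \sum_(i < N) \sum_(j < N) mono (co p i j) i j.
Proof.
move=> b; apply: coP => k l; rewrite co_sum.
under eq_bigr => i _ do (rewrite co_sum; under eq_bigr => j _ do rewrite co_mono).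
case: (ltnP k N) => [kN|kN]; last first.
  rewrite b ?kN // big1 // => i _; apply: big1 => j _.
  by case: eqP => // ki; move: kN; rewrite ki leqNgt ltn_ord.
rewrite (bigD1 (Ordinal kN)) //= [X in _ + X]big1 ?addr0; last first.
  by move=> i ni; apply: big1 => j _; rewrite eq_sym; move: ni; rewrite -val_eqE /= => /negPf ->.
rewrite eqxx /=.
case: (ltnP l N) => [lN|lN]; last first.
  rewrite b ?lN ?orbT // big1 // => j _.
  by case: eqP => // ki; move: lN; rewrite ki leqNgt ltn_ord.
rewrite (bigD1 (Ordinal lN)) //= [X in _ + X]big1 ?addr0 ?eqxx //.
by move=> i ni; rewrite eq_sym; move: ni; rewrite -val_eqE /= => /negPf ->.
Qed.

Lemma smulA p q r : smul p (smul q r) = smul (smul p q) r.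
Proof.
rewrite /smul -pact_smul //.
- exact: scalDl. - exact: scalDr. - exact: scalA. - exact: multX_scal.
- exact: multY_scal. - exact: multXY.
Qed.
Lemma scal_mono f g i j : scal f (mono g i j) = mono (f * g) i j.
Proof. by apply: coP => k l; rewrite co_scal !co_mono; case: ifP; rewrite ?mulr0. Qed.
Lemma smul1r p : smul sone p = p.
Proof.
have b : bound 1 sone by move=> i j; rewrite co_mono; case: i; case: j.
rewrite /smul (pactE _ _ scalDl _ b) !big_ord1 /= co_mono /=.
by apply: coP => i j; rewrite co_scal mul1r.
Qed.
Lemma smulr1 p : smul p sone = p.
Proof.
have [N b] := bound_exists p.
rewrite /smul (pactE _ _ scalDl _ b) [RHS](symbE b).
apply: eq_bigr => i _; apply: eq_bigr => j _.
by rewrite iter_multY_mono ?bdy1 // iter_multX_mono ?bdx1 // scal_mono mulr1 !addn0.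
Qed.
Lemma smulDl : left_distributive smul +%R.
Proof. by move=> p q r; rewrite /smul pactDl //; exact: scalDl. Qed.
Lemma smulDr : right_distributive smul +%R.
Proof. by move=> p q r; rewrite /smul pactDr //; exact: scalDr. Qed.
HB.instance Definition _ := GRing.Zmodule_isPzRing.Build D smulA smul1r smulr1 smulDl smulDr.
End Action.

(** * Leading coefficients modulo left multiples of H *)

Section Leading.
Variables (A : comNzRingType) (d : biderivation A) (C : numFieldType) (ev : {rmorphism A -> C}).
Local Notation D := (symb d).
Local Notation dx := (bdx d).
Local Notation dy := (bdy d).
Implicit Types (p q : D) (f g : A).

(* All derivatives of order at most [n] vanish at the base point of [ev]. *)
Fixpoint vanishes n f : Prop :=
  ev f = 0 /\ if n is m.+1 then vanishes m (dx f) /\ vanishes m (dy f) else True.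
Definition flat f := forall n, vanishes n f.

Lemma vanishes_ev n f : vanishes n f -> ev f = 0. Proof. by case: n => [|n] []. Qed.
Lemma vanishesS n f : vanishes n.+1 f -> vanishes n f.
Proof. by elim: n f => [|n IH] f [e0 [ex ey]] //; do 2?split; auto. Qed.
Lemma vanishes0 n : vanishes n 0.
Proof. by elim: n => [|n IH] /=; rewrite !raddf0. Qed.
Lemma vanishesD n f g : vanishes n f -> vanishes n g -> vanishes n (f + g).
Proof.
elim: n f g => [|n IH] f g [f0 fd] [g0 gd]; rewrite /= rmorphD f0 g0 addr0 ?raddfD //.
by case: fd gd => [? ?] [? ?]; do 2?split; auto.
Qed.
Lemma vanishesM n f g : vanishes n f -> vanishes n (g * f).
Proof.
elim: n f g => [|n IH] f g; first by rewrite /= rmorphM => -[-> _]; rewrite mulr0.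
move=> h; have h1 := vanishesS h; case: h => f0 [hx hy] /=.
by rewrite rmorphM f0 mulr0 bdxM bdyM; do 2?split; auto; apply: vanishesD; auto.
Qed.
(** Induction on the order: [l * dg = d(l * g) - dl * g], where [g] is already known to vanish to
    the previous order. *)
Lemma vanishes_unit n l g : ev l != 0 -> vanishes n (l * g) -> vanishes n g.
Proof.
move=> l0; elim: n g => [|n IH] g.
  by rewrite /= rmorphM => -[/eqP + _]; rewrite mulf_eq0 (negPf l0) => /eqP.
move=> h; have g1 := IH _ (vanishesS h); case: h => e0 [hx hy].
split; first exact: vanishes_ev g1.
have opp k : vanishes n k -> vanishes n (- k) by move=> ?; rewrite -mulN1r; exact: vanishesM.
split; apply: IH.
  have -> : l * dx g = dx (l * g) - dx l * g by rewrite bdxM addrC addKr.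
  by apply: vanishesD => //; apply: opp; exact: vanishesM.
have -> : l * dy g = dy (l * g) - dy l * g by rewrite bdyM addrC addKr.
by apply: vanishesD => //; apply: opp; exact: vanishesM.
Qed.

Lemma flat0 : flat 0. Proof. by move=> n; exact: vanishes0. Qed.
Lemma flatD f g : flat f -> flat g -> flat (f + g).
Proof. by move=> hf hg n; apply: vanishesD. Qed.
Lemma flatMl f g : flat f -> flat (g * f).
Proof. by move=> hf n; apply: vanishesM. Qed.
Lemma flatMr f g : flat f -> flat (f * g).
Proof. by rewrite mulrC; exact: flatMl. Qed.
Lemma flatN f : flat f -> flat (- f).
Proof. by rewrite -mulN1r; exact: flatMl. Qed.
Lemma flatB f g : flat f -> flat g -> flat (f - g).
Proof. by move=> hf hg; apply: flatD => //; exact: flatN. Qed.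
Lemma flat_dx f : flat f -> flat (dx f).
Proof. by move=> hf n; case: (hf n.+1) => _ []. Qed.
Lemma flat_dy f : flat f -> flat (dy f).
Proof. by move=> hf n; case: (hf n.+1) => _ []. Qed.
Lemma flat_sum I r (P : pred I) (F : I -> A) :
  (forall i, P i -> flat (F i)) -> flat (\sum_(i <- r | P i) F i).
Proof. by move=> h; apply: (big_ind flat) => //; [exact: flat0 | exact: flatD]. Qed.
Lemma flat_iter_dy n f : flat f -> flat (iter n dy f).
Proof. by move=> h; elim: n => //= n; exact: flat_dy. Qed.

(* A solution of a first-order linear system with invertible leading
   coefficient is determined by its value at one point. *)
Lemma flat_of_ode (n k : nat) l e : (0 < n)%N -> ev l != 0 -> ev e = 0 -> flat (dy e) ->
  flat (l * dx e *+ n - e * dx l *+ k) -> flat e.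
Proof.
move=> n0 l0 e0 ey eq; elim=> [|m IH]; first by [].
split=> //; split; last exact: ey.
apply: (@vanishes_unit _ (l *+ n)).
  by rewrite rmorphMn /= mulrn_eq0 negb_or -lt0n n0.
(* The equation bounds [dx e] by [e]: order [m] for [e] gives order [m] for [dx e], hence order
   [m.+1] for [e]. *)
have -> : l *+ n * dx e = (l * dx e *+ n - e * dx l *+ k) + (dx l *+ k) * e.
  by rewrite !mulrnAl [dx l * e]mulrC subrK.
by apply: vanishesD => //; exact: vanishesM.
Qed.

(** Flatness is stable under differentiation, so operators with flat coefficients form a two-sided
    ideal; vanishing at the point alone would not suffice. *)
Definition flatc p := forall i j, flat (co p i j).
Lemma flatcD p q : flatc p -> flatc q -> flatc (p + q).
Proof. by move=> hp hq i j; rewrite coD; apply: flatD. Qed.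
Lemma flatcB p q : flatc p -> flatc q -> flatc (p - q).
Proof. by move=> hp hq i j; rewrite coB; apply: flatB. Qed.
Lemma flatc_multX p : flatc p -> flatc (multX p).
Proof.
move=> h i j; rewrite co_multX; apply: flatD; first exact: flat_dx.
by case: i => // *; exact: flat0.
Qed.
Lemma flatc_multY p : flatc p -> flatc (multY p).
Proof.
move=> h i j; rewrite co_multY; apply: flatD; first exact: flat_dy.
by case: j => // *; exact: flat0.
Qed.

Lemma co_mul N p q i j : bound N p -> co (p * q) i j =
  \sum_(a < N) \sum_(b < N) co p a b * co (iter a (@multX _ d) (iter b (@multY _ d) q)) i j.
Proof.
move=> hb; rewrite [p * q](pactE _ _ (@scalDl _ d) _ hb) co_sum.
apply: eq_bigr => a _; rewrite co_sum; apply: eq_bigr => b _.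
by rewrite co_scal.
Qed.

Lemma flatc_mull p q : flatc p -> flatc (p * q).
Proof.
move=> h i j; have [N hb] := bound_exists p; rewrite (co_mul _ _ _ hb).
by apply: flat_sum => a _; apply: flat_sum => b _; apply: flatMr.
Qed.
Lemma flatc_mulr p q : flatc q -> flatc (p * q).
Proof.
move=> h i j; have [N hb] := bound_exists p; rewrite (co_mul _ _ _ hb).
apply: flat_sum => a _; apply: flat_sum => b _; apply: flatMl.
suff: flatc (iter a (@multX _ d) (iter b (@multY _ d) q)) by exact.
elim: (a : nat) => [|m IH] /=; last exact: flatc_multX.
by elim: (b : nat) => [|m IH] //=; exact: flatc_multY.
Qed.

Definition degX_le k p := forall i j, (k < i)%N -> co p i j = 0.

Lemma degX_le_multX k p : degX_le k p -> degX_le k.+1 (multX p).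
Proof.
move=> h [|i] j //; rewrite ltnS => l; rewrite co_multX h ?raddf0 ?h ?addr0 //.
exact: ltnW.
Qed.
Lemma degX_le_multY k p : degX_le k p -> degX_le k (multY p).
Proof.
move=> h i j l; rewrite co_multY h // raddf0; case: j => [|j]; rewrite ?addr0 //.
by rewrite h // addr0.
Qed.
Lemma degX_le_iterX k p a : degX_le k p -> degX_le (a + k) (iter a (@multX _ d) p).
Proof. by move=> h; elim: a => //= a; exact: degX_le_multX. Qed.
Lemma degX_le_iterY k p a : degX_le k p -> degX_le k (iter a (@multY _ d) p).
Proof. by move=> h; elim: a => //= a; exact: degX_le_multY. Qed.
Lemma top_iterX k p a j : degX_le k p ->
  co (iter a (@multX _ d) p) (a + k) j = co p k j.
Proof.
move=> h; elim: a => //= a IH; rewrite addSn co_multX IH.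
by rewrite (degX_le_iterX h) ?raddf0 ?add0r.
Qed.
(** Moving [X^a] past the coefficient of [X^(k+1)] leaves [a] copies of its derivative one degree
    lower. *)
Lemma subtop_iterX k p a j : degX_le k.+1 p ->
  co (iter a (@multX _ d) p) (a + k) j = co p k j + dx (co p k.+1 j) *+ a.
Proof.
move=> h; elim: a => [|a IH]; first by rewrite addr0.
by rewrite /= addSn co_multX IH -addnS top_iterX // addrCA -mulrS.
Qed.
Lemma iterY_col0 p b i : co (iter b (@multY _ d) p) i 0 = iter b dy (co p i 0).
Proof. by elim: b => //= b IH; rewrite co_multY IH addr0. Qed.

Lemma sum_only (V : nmodType) N n (F : nat -> V) : (forall i, i != n -> F i = 0) ->
  ((N <= n)%N -> F n = 0) -> \sum_(i < N) F i = F n.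
Proof.
move=> h1 h2; case: (ltnP n N) => [l|l].
  rewrite (bigD1 (Ordinal l)) //= big1 ?addr0 // => i; rewrite -val_eqE /=.
  exact: h1.
rewrite h2 // big1 // => i _; apply: h1; apply/eqP => e.
by move: l; rewrite -e leqNgt ltn_ord.
Qed.
Lemma sum_only2 (V : nmodType) N n (F : nat -> V) :
  (forall i, i != n -> i != n.+1 -> F i = 0) ->
  (forall i, (N <= i)%N -> F i = 0) -> \sum_(i < N) F i = F n + F n.+1.
Proof.
move=> h1 h2.
pose G m i := if i == m then F i else 0.
have e i : F i = G n i + G n.+1 i.
  rewrite /G; case: (i =P n) => [->|/eqP ni].
    by rewrite -[n == n.+1]negbK neq_ltn ltnSn addr0.
  by case: (i =P n.+1) => [_|/eqP ni1]; rewrite add0r // h1.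
under eq_bigr => i _ do rewrite e.
have s m : \sum_(i < N) G m i = F m.
  rewrite (sum_only (F := G m) (n := m)) /G ?eqxx //; last exact: h2.
  by move=> i /negPf ->.
by rewrite big_split /= !s.
Qed.

Definition reduced p := forall i j, co p i.+1 j.+1 = 0.

(** Only row [n.+1] of [p] reaches this degree, and since [p] is reduced and the index is positive,
    that row is a single coefficient at [Y^0]. *)
Lemma mul_toprow p q n k j : degX_le n.+1 p -> reduced p -> degX_le k q ->
  co (p * q) (n.+1 + k) j = co p n.+1 0 * co q k j.
Proof.
move=> hp rp hq; have [N hb] := bound_exists p; rewrite (co_mul _ _ _ hb).
rewrite (sum_only (n := n.+1) (F := fun a => \sum_(b < N) co p a b *
   co (iter a (@multX _ d) (iter b (@multY _ d) q)) (n.+1 + k) j)).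
- rewrite (sum_only (n := 0%N) (F := fun b => co p n.+1 b * 
   co (iter n.+1 (@multX _ d) (iter b (@multY _ d) q)) (n.+1 + k) j)).
  + by rewrite top_iterX.
  + by case=> // b _; rewrite rp mul0r.
  + by move=> l; rewrite hb ?l ?orbT // mul0r.
- move=> a; rewrite neq_ltn => /orP[l|l]; apply: big1 => b _; last by rewrite hp ?mul0r.
  by rewrite [X in _ * X](degX_le_iterX (degX_le_iterY _ hq)) ?mulr0 // ltn_add2r.
- by move=> l; apply: big1 => b _; rewrite hb ?l // mul0r.
Qed.

Lemma mul_degX_le p q n k : degX_le n p -> degX_le k q -> degX_le (n + k) (p * q).
Proof.
move=> hp hq i j l; have [N hb] := bound_exists p; rewrite (co_mul _ _ _ hb).
apply: big1 => a _; apply: big1 => b _; case: (leqP a n) => an; last by rewrite hp ?mul0r.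
rewrite [X in _ * X](degX_le_iterX (degX_le_iterY _ hq)) ?mulr0 //.
by apply: leq_ltn_trans l; rewrite leq_add2r.
Qed.

(** Row [n] of [p] may be row 0, whose pure Y-terms survive reduction. In column 0 they contribute
    only [dy]-derivatives of the top coefficient of [q], which are flat; hence an identity modulo
    flat functions. *)
Lemma mul_subtop p q n k : degX_le n.+1 p -> reduced p -> degX_le k.+1 q ->
  flat (dy (co q k.+1 0)) ->
  flat (co (p * q) (n + k.+1) 0 - (co p n 0 * co q k.+1 0 +
    co p n.+1 0 * (co q k 0 + dx (co q k.+1 0) *+ n.+1))).
Proof.
move=> hp rp hq hy; have [N hb] := bound_exists p; rewrite (co_mul _ _ _ hb).
rewrite (sum_only2 (n := n) (F := fun a => \sum_(b < N) co p a b *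
   co (iter a (@multX _ d) (iter b (@multY _ d) q)) (n + k.+1) 0)).
- rewrite [X in _ + X - _](sum_only (n := 0%N) (F := fun b => co p n.+1 b *
   co (iter n.+1 (@multX _ d) (iter b (@multY _ d) q)) (n + k.+1) 0)).
  + rewrite addnS -addSn subtop_iterX // addSn -addnS opprD addrACA subrr addr0.
    have key b : co p n b * co (iter n (@multX _ d) (iter b (@multY _ d) q)) (n + k.+1) 0 =
        co p n b * iter b dy (co q k.+1 0).
      by rewrite top_iterX ?iterY_col0 //; exact: degX_le_iterY.
    under eq_bigr => b _ do rewrite key.
    have hb' := boundW (leqnSn N) hb.
    (* Padding the range to [N.+1] allows the term [b = 0] to be split off whatever [N] is. *)
    have -> : \sum_(b < N) co p n b * iter b dy (co q k.+1 0) =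
              \sum_(b < N.+1) co p n b * iter b dy (co q k.+1 0).
      by rewrite big_ord_recr /= hb ?leqnn ?orbT // mul0r addr0.
    rewrite big_ord_recl /= addrC addKr; apply: flat_sum => b _; apply: flatMl.
    by have := flat_iter_dy b hy; rewrite -iterSr.
  + by case=> // b _; rewrite rp mul0r.
  + by move=> l; rewrite hb ?l ?orbT // mul0r.
- move=> a an an1; apply: big1 => b _.
  have [l|l] := ltnP a n.
    by rewrite [X in _ * X](degX_le_iterX (degX_le_iterY _ hq)) ?mulr0 // ltn_add2r.
  by rewrite hp ?mul0r // ltn_neqAle eq_sym an1 ltn_neqAle eq_sym an.
- by move=> a l; apply: big1 => b _; rewrite hb ?l // mul0r.
Qed.

Variable u : A.
Definition hsymb : D := mono d (-1) 1 1 + mono d u 0 0.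

Definition in_ideal p := exists t, p = t * hsymb.

(** Composition with XY on the right: no coefficient is differentiated, so it merely moves
    indices. *)
Definition shift p : D := map_poly (fun c => c * 'X) (p : {poly {poly A}}) * 'X.
Lemma co_shift p i j : co (shift p) i j =
  if (i, j) is (i'.+1, j'.+1) then co p i' j' else 0.
Proof.
rewrite /shift /co coefMX; case: i => [|i] /=; first by rewrite coef0.
by rewrite coef_map_id0 ?mul0r // coefMX; case: j.
Qed.
Lemma shift_add : additive shift.
Proof. by move=> p q; apply: coP => -[|i] [|j]; rewrite coB !co_shift ?subrr ?coB. Qed.
HB.instance Definition _ := GRing.isZmodMorphism.Build D D shift shift_add.

Lemma mul_mono11 p : p * mono d (-1) 1 1 = - shift p.
Proof.
have [N hb] := bound_exists p.
rewrite [_ * _](pactE _ _ (@scalDl _ d) _ hb) [in RHS](symbE hb) raddf_sum -sumrN.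
apply: eq_bigr => i _; rewrite raddf_sum -sumrN; apply: eq_bigr => j _.
rewrite iter_multY_mono ?iter_multX_mono ?raddfN ?bdx1 ?bdy1 ?oppr0 //.
rewrite scal_mono; apply: coP => k l; rewrite coN co_shift !co_mono !addn1 mulrN1.
by case: k => [|k]; case: l => [|l]; rewrite ?andbF ?oppr0 //= co_mono !eqSS; case: ifP; rewrite ?oppr0.
Qed.

Lemma mono11_mul p : mono d (-1) 1 1 * p = - multX (multY p).
Proof.
have hb : bound 2 (mono d (-1) 1 1) by move=> [|[|i]] [|[|j]] //=; rewrite co_mono ?andbF.
rewrite [_ * _](pactE _ _ (@scalDl _ d) _ hb).
rewrite !big_ord_recl !big_ord0 /= !co_mono /=.
apply: coP => i j; rewrite !coD !co_scal coN co0; ring.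
Qed.
Lemma mono00_mul f p : mono d f 0 0 * p = scal f p.
Proof.
have hb : bound 1 (mono d f 0 0) by move=> [|i] [|j] //=; rewrite co_mono ?andbF.
rewrite [_ * _](pactE _ _ (@scalDl _ d) _ hb) !big_ord1 /=.
by rewrite co_mono.
Qed.

Lemma degX_le_mono f : degX_le 0 (mono d f 0 0).
Proof. by move=> [|i] j //; rewrite co_mono. Qed.

(** Right multiplication by a function does not raise the X-degree: row [r] of the product only sees
    rows of [t] from [r] on. *)
Lemma flat_mul_mono t f r j : (forall i b, (r <= i)%N -> flat (co t i b)) ->
  flat (co (t * mono d f 0 0) r j).
Proof.
move=> h; have [N hb] := bound_exists t; rewrite (co_mul _ _ _ hb).
apply: flat_sum => a _; apply: flat_sum => b _.
case: (ltnP a r) => l; last by apply: flatMr; exact: h.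
by rewrite [X in _ * X](degX_le_iterX (degX_le_iterY _ (@degX_le_mono f))) ?mulr0 ?addn0 //; exact: flat0.
Qed.

(* The top X-coefficient of a multiple of H is divisible by Y. *)
Lemma in_ideal_top p m : in_ideal p -> (forall i j, (m < i)%N -> flat (co p i j)) -> flat (co p m 0).
Proof.
case=> t -> h; have [N hb] := bound_exists t.
(* Descending induction on the row of [t]: the coefficient of [t * H] at [(i+1, j+1)] is flat by
   hypothesis, and equals minus that of [t] at [(i, j)] plus a contribution of the rows of [t] above
   [i]. *)
have ht s i j : (m <= i)%N -> (N <= i + s)%N -> flat (co t i j).
  elim: s i j => [|s IH] i j mi; first by rewrite addn0 => l; rewrite hb ?l //; exact: flat0.
  rewrite addnS -addSn => l; have := h i.+1 j.+1 mi.
  rewrite mulrDr coD mul_mono11 coN co_shift => h1.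
  have h2 : flat (co (t * mono d u 0 0) i.+1 j.+1).
    apply: flat_mul_mono => i' b li; apply: IH; first by rewrite (leq_trans mi) // ltnW.
    by apply: leq_trans l _; rewrite leq_add2r.
  by have := flatN (flatB h1 h2); rewrite addrK opprK.
rewrite mulrDr coD mul_mono11 coN co_shift; case: m {h} ht => [|m] ht.
  by rewrite oppr0 add0r; apply: flat_mul_mono => i b li; apply: (ht N) => //; exact: leq_addl.
by rewrite oppr0 add0r; apply: flat_mul_mono => i b li; apply: (ht N) => //; exact: leq_addl.
Qed.

(** The degree computations need rows that are exactly zero, while only flatness is available.
    Cutting off the flat rows changes commutators by flat coefficients only ([comm_flat]). *)
Definition truncX k p : D := \poly_(i < k.+1) (p : {poly {poly A}})`_i.
Lemma co_truncX k p i j : co (truncX k p) i j = if (i <= k)%N then co p i j else 0.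
Proof. by rewrite /co coef_poly ltnS; case: ifP; rewrite ?coef0. Qed.
Lemma degX_le_truncX k p : degX_le k (truncX k p).
Proof. by move=> i j; rewrite co_truncX ltnNge => /negPf ->. Qed.
Lemma reduced_truncX k p : reduced p -> reduced (truncX k p).
Proof. by move=> h i j; rewrite co_truncX h; case: ifP. Qed.
Definition flat_degX_le k p := forall i j, (k < i)%N -> flat (co p i j).
Lemma truncX_flat k p : flat_degX_le k p -> flatc (p - truncX k p).
Proof.
move=> h i j; rewrite coB co_truncX; case: leqP => l; first by rewrite subrr; exact: flat0.
by rewrite subr0; exact: h.
Qed.
Definition comm p q := p * q - q * p.
Lemma comm_flat p q p' q' : flatc (p - p') -> flatc (q - q') ->
  flatc (comm p q - comm p' q').
Proof.
move=> hp hq; have -> : comm p q - comm p' q' =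
   ((p - p') * q + p' * (q - q')) - ((q - q') * p + q' * (p - p')).
  rewrite /comm !mulrBl !mulrBr !addrA !subrK.
  by rewrite !opprD !opprK !addrA; congr (_ + _); rewrite -!addrA; congr (_ + _); rewrite addrC.
by apply: flatcB; apply: flatcD; by [apply: flatc_mull | apply: flatc_mulr].
Qed.

Lemma in_ideal_top_flat p p' m : in_ideal p -> flatc (p - p') -> flat_degX_le m p' -> flat (co p' m 0).
Proof.
move=> hp hf h.
have e i j : co p' i j = co p i j - co (p - p') i j by rewrite coB opprB addrCA subrr addr0.
rewrite e; apply: flatB => //; apply: in_ideal_top => // i j l.
rewrite -[co p i j](subrK (co p' i j)) -coB; apply: flatD => //; exact: h.
Qed.

(** At [X^(k+1) Y^0] the product [E XY] contributes nothing and the terms with [u] have too low an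
    X-degree. What remains comes from [XY E] and is the y-derivative of the top coefficient. *)
Lemma flat_comm_h E k : in_ideal (comm E hsymb) -> flat_degX_le k E -> flat (dy (co E k 0)).
Proof.
move=> hJ hE; set E' := truncX k E.
have hE' : degX_le k E' by exact: degX_le_truncX.
have -> : co E k 0 = co E' k 0 by rewrite co_truncX leqnn.
have hf : flatc (comm E hsymb - comm E' hsymb).
  by apply: comm_flat; [exact: truncX_flat | move=> i j; rewrite subrr co0; exact: flat0].
have xh : degX_le 1 hsymb.
  by move=> [|[|i]] j //; rewrite coD !co_mono /= addr0.
have cx : degX_le k.+1 (comm E' hsymb).
  move=> i j l; rewrite coB (mul_degX_le hE' xh) ?addn1 //.
  by rewrite (mul_degX_le xh hE') ?subrr // add1n.
have := in_ideal_top_flat (m := k.+1) hJ hf; suff -> : co (comm E' hsymb) k.+1 0 = dy (co E' k 0).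
  by apply => i j l; rewrite cx //; exact: flat0.
rewrite coB mulrDr mulrDl !coD mul_mono11 coN co_shift oppr0 add0r.
rewrite [X in X - _](mul_degX_le hE' (@degX_le_mono u)) ?addn0 // mono00_mul co_scal hE' // mulr0 addr0.
rewrite mono11_mul coN opprK add0r.
have := top_iterX 1 0 (degX_le_multY hE'); rewrite /= add1n => ->.
by rewrite co_multY addr0.
Qed.

(** In X-degree [n + k + 2] the two products cancel because coefficients commute. Degree [n + k + 1]
    is then the top one up to flat terms; [mul_subtop] evaluates its column 0 and
    [in_ideal_top_flat] makes it flat. *)
Lemma flat_comm L E n k : in_ideal (comm L hsymb) -> in_ideal (comm E hsymb) -> in_ideal (comm L E) ->
  reduced L -> reduced E -> flat_degX_le n.+1 L -> flat_degX_le k.+1 E ->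
  flat (co L n.+1 0 * dx (co E k.+1 0) *+ n.+1 - co E k.+1 0 * dx (co L n.+1 0) *+ k.+1).
Proof.
move=> JL JE JLE rL rE hL hE; set L' := truncX n.+1 L; set E' := truncX k.+1 E.
have xL : degX_le n.+1 L' by exact: degX_le_truncX.
have xE : degX_le k.+1 E' by exact: degX_le_truncX.
have yL := flat_comm_h JL hL; have yE := flat_comm_h JE hE.
have eL : co L n.+1 0 = co L' n.+1 0 by rewrite co_truncX leqnn.
have eE : co E k.+1 0 = co E' k.+1 0 by rewrite co_truncX leqnn.
rewrite eL eE in yL yE *.
have rL' : reduced L' by exact: reduced_truncX.
have rE' : reduced E' by exact: reduced_truncX.
have hf : flatc (comm L E - comm L' E') by apply: comm_flat; exact: truncX_flat.
have := in_ideal_top_flat (m := (n + k.+1)%N) JLE hf.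
have m1 := mul_subtop xL rL' xE yE.
have := mul_subtop xE rE' xL yL; rewrite addnS addnC -addnS => m2.
have cx : flat_degX_le (n + k.+1) (comm L' E').
  move=> i j; rewrite leq_eqVlt => /orP[/eqP <-|l]; last first.
    rewrite coB (mul_degX_le xL xE) ?(mul_degX_le xE xL) ?subrr //; last by rewrite addnC.
    exact: flat0.
  rewrite coB -addSn mul_toprow // addnC mul_toprow //.
  case: j => [|j]; first by rewrite mulrC subrr; exact: flat0.
  by rewrite rL' rE' !mulr0 subrr; exact: flat0.
move=> /(_ cx); rewrite coB => m0.
have := flatD (flatB m0 m1) m2.
set a := co (L' * E') _ _; set b := co (E' * L') _ _.
set l1 := co L' n.+1 0; set e1 := co E' k.+1 0; set l0 := co L' n 0; set e0 := co E' k 0.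
suff -> : a - b - (a - (l0 * e1 + l1 * (e0 + dx e1 *+ n.+1))) +
  (b - (e0 * l1 + e1 * (l0 + dx l1 *+ k.+1))) = l1 * dx e1 *+ n.+1 - e1 * dx l1 *+ k.+1 by [].
rewrite -!mulrnAr; move: (dx e1 *+ n.+1) (dx l1 *+ k.+1) => x y; ring.
Qed.

(** Descending induction on the X-degree. The top coefficient is flat by the differential equation
    against [L], or, when [E] is congruent to some [G] of X-degree 0, because it is the top
    coefficient of [E - G] up to a flat term. *)
Lemma flat_rows E : in_ideal (comm E hsymb) -> reduced E -> (forall i, ev (co E i 0) = 0) ->
  (exists G, in_ideal (E - G) /\ flat_degX_le 0 G) \/
  (exists L n, [/\ in_ideal (comm L hsymb), in_ideal (comm L E), reduced L, flat_degX_le n.+1 L & ev (co L n.+1 0) != 0]) ->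
  flat_degX_le 0 E /\ flat (dy (co E 0 0)).
Proof.
move=> JE rE e0 hyp; suff h : flat_degX_le 0 E by split=> //; exact: flat_comm_h.
have [N hb] := bound_exists E.
suff key s k : (N <= k + s)%N -> flat_degX_le k E by apply: (key N); rewrite add0n.
elim: s k => [|s IH] k; first by rewrite addn0 => l i j ki; rewrite hb ?(leq_trans l (ltnW ki)) //; exact: flat0.
rewrite addnS -addSn => /IH hk i j; rewrite leq_eqVlt => /orP[/eqP <-|]; last exact: hk.
case: j => [|j]; last by rewrite rE; exact: flat0.
case: hyp => [[G [JG hG]]|[L [n [JL JLE rL hL l0]]]].
  rewrite -[co E _ _](subrK (co G k.+1 0)) -coB; apply: flatD; last exact: hG.
  apply: in_ideal_top => // i' j' l; rewrite coB; apply: flatB; first exact: hk.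
  exact/hG/(leq_trans _ l).
apply: (@flat_of_ode n.+1 k.+1 (co L n.+1 0)) => //; first exact: flat_comm_h.
exact: flat_comm.
Qed.
End Leading.

(** * Congruences modulo the left ideal generated by H *)

Section Reduction.
Variables (A : comNzRingType) (d : biderivation A) (u : A).
Local Notation D := (symb d).
Local Notation dx := (bdx d).
Local Notation dy := (bdy d).
Local Notation h := (hsymb d u).
Local Notation J := (in_ideal (d := d) u).
Implicit Types (p q l : D).

Definition symb_of_coef N (F : nat -> nat -> A) : D := \poly_(i < N) \poly_(j < N) F i j.
Lemma co_symb_of_coef N F i j : co (symb_of_coef N F) i j = if (i < N)%N && (j < N)%N then F i j else 0.
Proof. by rewrite /co coef_poly; case: ifP; rewrite ?coef0 // coef_poly. Qed.

Lemma in_idealD p q : J p -> J q -> J (p + q).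
Proof. by case=> s -> [t ->]; exists (s + t); rewrite mulrDl. Qed.
Lemma in_idealN p : J p -> J (- p).
Proof. by case=> s ->; exists (- s); rewrite mulNr. Qed.
Lemma in_idealB p q : J p -> J q -> J (p - q).
Proof. by move=> ? ?; apply: in_idealD => //; exact: in_idealN. Qed.
Lemma in_ideal0 : J 0.
Proof. by exists 0; rewrite mul0r. Qed.
Lemma in_idealMl p q : J q -> J (p * q).
Proof. by case=> t ->; exists (p * t); rewrite mulrA. Qed.
Lemma in_ideal_mulh p : J (p * h). Proof. by exists p. Qed.

(** The idealizer of the left ideal: right multiplication by such an [l] preserves it, which makes
    congruence compatible with products ([in_ideal_mul_cong]). *)
Definition normal l := J (comm l h).
Lemma in_idealMr p l : normal l -> J p -> J (p * l).
Proof.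
move=> nl [t ->]; have -> : t * h * l = t * l * h - t * comm l h.
  by rewrite /comm mulrBr opprB !mulrA addrC subrK.
by apply: in_idealB; [exact: in_ideal_mulh | exact: in_idealMl].
Qed.

Lemma commM p q l : comm (p * q) l = p * comm q l + comm p l * q.
Proof. by rewrite /comm mulrBr mulrBl !mulrA addrA subrK. Qed.
Lemma in_ideal_commM p q l : normal q -> J (comm p l) -> J (comm q l) -> J (comm (p * q) l).
Proof. by move=> nq hp hq; rewrite commM; apply: in_idealD; [exact: in_idealMl | exact: in_idealMr]. Qed.
Lemma normalM p q : normal p -> normal q -> normal (p * q).
Proof. by move=> np nq; exact: in_ideal_commM. Qed.
Lemma comm_eq0 p q : p * q = q * p -> comm p q = 0.
Proof. by move=> e; rewrite /comm e subrr. Qed.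
Lemma in_ideal_comm_exp p l n : normal p -> J (comm p l) -> normal (p ^+ n) /\ J (comm (p ^+ n) l).
Proof.
move=> np hp; elim: n => [|n [nn hn]].
  by rewrite expr0 /normal !comm_eq0 ?mulr1 ?mul1r //; split; exact: in_ideal0.
by rewrite exprS; split; [exact: normalM | exact: in_ideal_commM].
Qed.

Lemma comm_antisym p q : comm p q = - comm q p.
Proof. by rewrite /comm opprB. Qed.
Lemma commDl p q l : comm (p + q) l = comm p l + comm q l.
Proof. by rewrite /comm mulrDl mulrDr opprD addrACA. Qed.
Lemma commNl p l : comm (- p) l = - comm p l.
Proof. by rewrite /comm mulNr mulrN -opprD. Qed.

Lemma in_ideal_comm_sub l t q : normal q -> J (comm l q) -> J (comm (l - t * h) q).
Proof.
move=> nq hl; rewrite commDl commNl; apply: in_idealB => //; apply: in_idealB.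
  by apply: in_idealMr => //; exact: in_ideal_mulh.
by apply: in_idealMl; exact: in_ideal_mulh.
Qed.
Lemma normal_h : normal h.
Proof. by rewrite /normal comm_eq0 //; exact: in_ideal0. Qed.

Lemma in_ideal_mul_cong a a' b b' : normal b -> J (a - a') -> J (b - b') -> J (a * b - a' * b').
Proof.
move=> nb ha hb; have -> : a * b - a' * b' = (a - a') * b + a' * (b - b').
  by rewrite mulrBl mulrBr addrA subrK.
by apply: in_idealD; [exact: in_idealMr | exact: in_idealMl].
Qed.
Lemma in_ideal_exp_cong a a' n : normal a -> J (a - a') -> J (a ^+ n - a' ^+ n).
Proof.
move=> na ha; elim: n => [|n IH]; first by rewrite subrr; exact: in_ideal0.
rewrite !exprSr; exact: in_ideal_mul_cong.
Qed.

Lemma mulE N p q : bound N p -> p * q =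
  \sum_(i < N) \sum_(j < N) scal (co p i j) (iter i (@multX _ d) (iter j (@multY _ d) q)).
Proof. exact: (pactE _ _ (@scalDl _ d)). Qed.

Lemma iter_mul_zero M i j a b q :
  (forall i j, (M <= i)%N || (M <= j)%N -> co q i j = 0) ->
  (a + M <= i)%N || (b + M <= j)%N ->
  co (iter a (@multX _ d) (iter b (@multY _ d) q)) i j = 0.
Proof.
move=> hq; have hY i' j' : (M <= i')%N || (b + M <= j')%N -> co (iter b (@multY _ d) q) i' j' = 0.
  elim: b i' j' => [|b IH] i' j'; first exact: hq.
  rewrite addSn /= co_multY => /orP[l|l].
    by rewrite IH ?l // raddf0; case: j' => [|j']; rewrite ?IH ?l ?addr0.
  by rewrite IH ?(ltnW l) ?orbT // raddf0 add0r; case: j' l => // j'; rewrite ltnS => l; rewrite IH ?l ?orbT.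
elim: a i j => [|a IH] i j; first exact: hY.
rewrite addSn /= co_multX => /orP[l|l].
  by rewrite IH ?(ltnW l) // raddf0 add0r; case: i l => // i; rewrite ltnS => l; rewrite IH ?l.
by rewrite IH ?l ?orbT // raddf0; case: i => [|i]; rewrite ?IH ?l ?orbT ?addr0.
Qed.

Lemma bound_mul N M p q : bound N p -> bound M q -> bound (N + M) (p * q).
Proof.
move=> hp hq i j l; rewrite (co_mul _ _ _ hp); apply: big1 => a _; apply: big1 => b _.
rewrite (iter_mul_zero hq) ?mulr0 //.
by case/orP: l => l; apply/orP; [left|right]; apply: leq_trans l; rewrite leq_add2r ltnW.
Qed.

(** Expanding [X^a Y^b f] by Leibniz only yields [X^i Y^j] with [i <= a] and [j <= b]. *)
Lemma mul_mono00_zero p f i j :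
  (forall a b, (i <= a)%N -> (j <= b)%N -> co p a b = 0) -> co (p * mono d f 0 0) i j = 0.
Proof.
move=> hz; have [N hb] := bound_exists p; rewrite (co_mul _ _ _ hb).
apply: big1 => a _; apply: big1 => b _.
case: (leqP i a) => ia; last first.
  rewrite (@iter_mul_zero 1) ?addn1 ?ia ?mulr0 // => a' b' l.
  by rewrite co_mono; case: a' b' l => [|a'] [|b'].
case: (leqP j b) => jb; first by rewrite hz ?mul0r.
rewrite (@iter_mul_zero 1) ?addn1 ?jb ?orbT ?mulr0 // => a' b' l.
by rewrite co_mono; case: a' b' l => [|a'] [|b'].
Qed.

(* [XY] is congruent to [u] modulo left multiples of [H], so mixed monomials
   can be eliminated without raising either degree. *)
Lemma reduction N p : bound N p -> exists r, [/\ reduced r, bound N r & J (p - r)].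
Proof.
move=> hN; have : forall i j, (N <= j)%N -> co p i j = 0.
  by move=> i j l; rewrite hN ?l ?orbT.
move: {1}N => m; elim: m p hN => [|m IH] p hN hm.
  exists 0; split; first by move=> i j; rewrite co0.
    by move=> i j; rewrite co0.
  have -> : p = 0 by apply: coP => i j; rewrite hm ?co0.
  by rewrite subrr; exact: in_ideal0.
(* The quotient of the mixed part by XY: [shift p'] is [p' XY], congruent to [p' u], whose bound on
   the Y-degree is one lower. *)
pose p' := symb_of_coef N (fun i j => co p i.+1 j.+1).
have cp' i j : co p' i j = co p i.+1 j.+1.
  rewrite co_symb_of_coef; case: ltnP => /= l; last by rewrite hN // (leqW l).
  by case: ltnP => // l'; rewrite hN // (leqW l') orbT.
have hp' a b : (N <= a)%N || (N <= b)%N -> co p' a b = 0.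
  by rewrite cp' => /orP[l|l]; apply: hN; rewrite (leqW l) ?orbT.
have [||r [rr hr [t ht]]] := IH (p' * mono d u 0 0).
- move=> i j l; apply: mul_mono00_zero => a b ia jb; apply: hp'.
  by case/orP: l => l; [rewrite (leq_trans l ia) | rewrite (leq_trans l jb) orbT].
- move=> i j l; apply: mul_mono00_zero => a b ia jb; rewrite cp' hm // ltnS.
  exact: leq_trans jb.
exists (p - shift p' + r); split.
- by move=> i j; rewrite coD rr addr0 coB co_shift cp' subrr.
- move=> i j l; rewrite coD hr // addr0 coB co_shift hN // sub0r.
  by case: i j l => [|i] [|j] l; rewrite ?oppr0 // cp' hN ?oppr0.
- exists (t - p'); rewrite mulrBl -ht /hsymb mulrDr mul_mono11.
  move: (p' * _) (shift p') => a b.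
  rewrite opprD opprB addrA [p + _]addrC subrK opprD opprK [b - a]addrC addrACA.
  by rewrite subrr add0r addrC.
Qed.
End Reduction.

(** * Exchange of the two variables *)

Section Swap.
Variables (A : comNzRingType) (d : biderivation A).
Local Notation d' := (biderivation_swap d).

Definition swap_symb (p : symb d) : symb d' := swapXY p.
Lemma co_swap_symb p i j : co (swap_symb p) i j = co p j i.
Proof. exact: coef_swapXY. Qed.
Lemma swap_symb_add : additive swap_symb.
Proof. by move=> p q; apply: coP => i j; rewrite coB !co_swap_symb coB. Qed.
HB.instance Definition _ := GRing.isZmodMorphism.Build (symb d) (symb d') swap_symb swap_symb_add.
Lemma swap_symb_scal f p : swap_symb (scal f p) = scal f (swap_symb p).
Proof. by apply: coP => i j; rewrite co_scal !co_swap_symb co_scal. Qed.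
Lemma swap_symb_multX p : swap_symb (multX p) = multY (swap_symb p).
Proof. by apply: coP => i j; rewrite co_multY !co_swap_symb co_multX; case: j => [|j]; rewrite ?co_swap_symb. Qed.
Lemma swap_symb_multY p : swap_symb (multY p) = multX (swap_symb p).
Proof. by apply: coP => i j; rewrite co_multX !co_swap_symb co_multY; case: i => [|i]; rewrite ?co_swap_symb. Qed.
Lemma swap_symb_mono f i j : swap_symb (mono d f i j) = mono d' f j i.
Proof. by apply: coP => k l; rewrite co_swap_symb !co_mono andbC. Qed.
Lemma swap_symb_hsymb u : swap_symb (hsymb d u) = hsymb d' u.
Proof. by rewrite raddfD /= !swap_symb_mono. Qed.
(** The exchange reverses the order in which powers of X and Y are applied, which is harmless since
    [multX] and [multY] commute. *)
Lemma swap_symbM p q : swap_symb (p * q) = swap_symb p * swap_symb q.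
Proof.
have [N hb] := bound_exists p.
have hb' : bound N (swap_symb p) by move=> i j l; rewrite co_swap_symb hb // orbC.
rewrite (mulE _ hb) (mulE _ hb') raddf_sum /= [RHS]exchange_big /=.
apply: eq_bigr => i _; rewrite raddf_sum; apply: eq_bigr => j _ /=.
rewrite swap_symb_scal co_swap_symb; congr scal.
have e a b v : iter a (@multX _ d') (iter b (@multY _ d') v) =
               iter b (@multY _ d') (iter a (@multX _ d') v).
  elim: a => //= a ->; elim: b => //= b <-; exact: multXY.
rewrite e; elim: (i : nat) => [|a /= <-] /=; last by rewrite swap_symb_multX.
by elim: (j : nat) => [|b /= <-] //=; rewrite swap_symb_multY.
Qed.
Lemma swap_symb1 : swap_symb 1 = 1.
Proof. exact: swap_symb_mono. Qed.
HB.instance Definition _ := GRing.isMonoidMorphism.Build (symb d) (symb d') swap_symb (conj swap_symb1 swap_symbM).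
Lemma swap_symb_comm p q : swap_symb (comm p q) = comm (swap_symb p) (swap_symb q).
Proof. by rewrite /comm raddfB /= !swap_symbM. Qed.
Lemma swap_symb_in_ideal u p : in_ideal u p -> in_ideal u (swap_symb p).
Proof. by case=> t ->; exists (swap_symb t); rewrite swap_symbM swap_symb_hsymb. Qed.
Lemma swap_symb_reduced p : reduced p -> reduced (swap_symb p).
Proof. by move=> h i j; rewrite co_swap_symb h. Qed.
Lemma vanishes_swap_symb (C : numFieldType) (ev : {rmorphism A -> C}) n f : vanishes d ev n f -> vanishes d' ev n f.
Proof. by elim: n f => [|n IH] f //= [? [? ?]]; do 2?split; auto. Qed.
End Swap.

Lemma nonzero_left_kernel (F : fieldType) (m n : nat) (M : 'M[F]_(m, n)) :
  (n < m)%N -> exists2 v : 'rV_m, v != 0 & v *m M = 0.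
Proof.
move=> lt; have: kermx M != 0.
  by rewrite kermx_eq0 -row_leq_rank -ltnNge (leq_ltn_trans (rank_leq_col _)).
by case/rowV0Pn => v /sub_kermxP vM v0; exists v.
Qed.

(** * Combinations with constant coefficients, studied in one variable *)

Section Relation.
Variables (A : comNzRingType) (d : biderivation A) (C : numFieldType).
Variables (ev : {rmorphism A -> C}) (iota : {rmorphism C -> A}) (u : A).
Hypothesis dx_iota : forall c, bdx d (iota c) = 0.
Hypothesis dy_iota : forall c, bdy d (iota c) = 0.
Local Notation D := (symb d).
Local Notation h := (hsymb d u).
Local Notation J := (in_ideal (d := d) u).
Local Notation flat := (flat d ev).
Implicit Types (p q l : D).

(** Constants are central, their derivatives being zero. *)
Lemma mul_iota p c : p * mono d (iota c) 0 0 = scal (iota c) p.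
Proof.
have [N hb] := bound_exists p; rewrite (mulE _ hb); apply: coP => i j.
rewrite [in RHS](symbE hb) co_scal !co_sum mulr_sumr; apply: eq_bigr => a _.
rewrite !co_sum mulr_sumr; apply: eq_bigr => b _.
rewrite iter_multY_mono // iter_multX_mono // !addn0 scal_mono !co_mono.
by case: ifP; rewrite ?mulr0 // mulrC.
Qed.
Lemma scal_mulr p q c : p * scal (iota c) q = scal (iota c) (p * q).
Proof. by rewrite -!(mono00_mul (iota c)) mulrA mul_iota -mono00_mul mulrA. Qed.
Lemma scal_mull p q c : scal (iota c) p * q = scal (iota c) (p * q).
Proof. by rewrite -!mono00_mul mulrA. Qed.
Lemma comm_scal p l c : comm (scal (iota c) p) l = scal (iota c) (comm p l).
Proof.
by rewrite /comm scal_mull scal_mulr -!mono00_mul mulrBr.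
Qed.
Lemma in_ideal_scal p c : J p -> J (scal (iota c) p).
Proof. by rewrite -mono00_mul; exact: in_idealMl. Qed.

Lemma in_ideal_sum I r (P : pred I) (F : I -> D) :
  (forall i, P i -> J (F i)) -> J (\sum_(i <- r | P i) F i).
Proof. by move=> hF; apply: (big_ind J) => //; [exact: in_ideal0 | move=> ? ?; exact: in_idealD]. Qed.
Lemma comm_suml I r (P : pred I) (F : I -> D) l :
  comm (\sum_(i <- r | P i) F i) l = \sum_(i <- r | P i) comm (F i) l.
Proof. by rewrite /comm mulr_suml mulr_sumr -sumrB. Qed.

Definition combination K (b : 'I_K -> 'I_K -> C) p q : D :=
  \sum_(r < K) \sum_(s < K) scal (iota (b r s)) (p ^+ r * q ^+ s).

Lemma in_ideal_comm_combination K (b : 'I_K -> 'I_K -> C) p q l :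
  normal u p -> normal u q -> J (comm p l) -> J (comm q l) -> J (comm (combination b p q) l).
Proof.
move=> np nq hp hq; rewrite comm_suml; apply: in_ideal_sum => r _.
rewrite comm_suml; apply: in_ideal_sum => s _; rewrite comm_scal; apply: in_ideal_scal.
have [_ h1] := in_ideal_comm_exp r np hp; have [n2 h2] := in_ideal_comm_exp s nq hq.
exact: in_ideal_commM.
Qed.
Lemma in_ideal_combination_cong K (b : 'I_K -> 'I_K -> C) p q p' q' :
  normal u p -> normal u q -> J (p - p') -> J (q - q') -> J (combination b p q - combination b p' q').
Proof.
move=> np nq hp hq; rewrite -sumrB; apply: in_ideal_sum => r _.
rewrite -sumrB; apply: in_ideal_sum => s _; rewrite -!mono00_mul -mulrBr; apply: in_idealMl.
apply: in_ideal_mul_cong; [|exact: in_ideal_exp_cong|exact: in_ideal_exp_cong].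
by have [] := in_ideal_comm_exp s nq (l := h) nq.
Qed.

Local Notation degX_le0 := (flat_degX_le ev 0).
Lemma flat_degX_le0D p q : degX_le0 p -> degX_le0 q -> degX_le0 (p + q).
Proof. by move=> hp hq i j l; rewrite coD; apply: flatD; [exact: hp | exact: hq]. Qed.
(** Each factor agrees with its truncation up to an operator with flat coefficients, and these form
    a two-sided ideal. *)
Lemma flat_degX_le0M p q : degX_le0 p -> degX_le0 q -> degX_le0 (p * q).
Proof.
move=> hp hq i j l.
have -> : p * q = (p - truncX 0 p) * q + truncX 0 p * (q - truncX 0 q) + truncX 0 p * truncX 0 q.
  by rewrite mulrBl mulrBr addrA subrK subrK.
rewrite !coD [X in _ + X](mul_degX_le (@degX_le_truncX _ _ 0 p) (@degX_le_truncX _ _ 0 q)) // addr0; apply: flatD.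
  exact: (flatc_mull _ (truncX_flat hp)).
exact: (flatc_mulr _ (truncX_flat hq)).
Qed.
Lemma flat_degX_le0_exp p n : degX_le0 p -> degX_le0 (p ^+ n).
Proof.
move=> hp; elim: n => [|n IH]; last by rewrite exprS; exact: flat_degX_le0M.
by move=> [|i] j // _; rewrite expr0 co_mono; exact: flat0.
Qed.
Lemma flat_degX_le0_combination K (b : 'I_K -> 'I_K -> C) p q : degX_le0 p -> degX_le0 q -> degX_le0 (combination b p q).
Proof.
move=> hp hq; apply: (big_ind degX_le0) => [||r _]; [by move=> *; rewrite co0; exact: flat0|exact: flat_degX_le0D|].
apply: (big_ind degX_le0) => [||s _]; [by move=> *; rewrite co0; exact: flat0|exact: flat_degX_le0D|].
move=> i j l; rewrite co_scal; apply: flatMl.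
by apply: flat_degX_le0M l; exact: flat_degX_le0_exp.
Qed.

(** The alternative that [flat_rows] needs, stated for a pair: the index [n.+1] is common, and one
    nonzero top coefficient is enough because every combination commutes with both operators modulo
    the ideal. *)
Definition generic p q :=
  (degX_le0 p /\ degX_le0 q) \/
  exists n, [/\ flat_degX_le ev n.+1 p, flat_degX_le ev n.+1 q & (ev (co p n.+1 0) != 0) || (ev (co q n.+1 0) != 0)].

Lemma flat_rows_combination K (b : 'I_K -> 'I_K -> C) p q e :
  normal u p -> normal u q -> J (comm p q) -> reduced p -> reduced q ->
  generic p q -> reduced e -> J (combination b p q - e) -> (forall i, ev (co e i 0) = 0) ->
  degX_le0 e /\ flat (bdy d (co e 0 0)).
Proof.
move=> np nq hpq rp rq gen re [t ht] e0.
have hqp : J (comm q p) by rewrite comm_antisym; exact: in_idealN.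
have eE : e = combination b p q - t * h by rewrite -ht opprB addrC subrK.
have Je l : normal u l -> J (comm (combination b p q) l) -> J (comm l e).
  by move=> nl hl; rewrite comm_antisym eE; apply: in_idealN; apply: in_ideal_comm_sub.
have ne : J (comm e h).
  rewrite eE; apply: in_ideal_comm_sub; first exact: normal_h.
  exact: in_ideal_comm_combination.
have Jp0 : J (comm p p) by rewrite comm_eq0 //; exact: in_ideal0.
have Jq0 : J (comm q q) by rewrite comm_eq0 //; exact: in_ideal0.
apply: (flat_rows ne re e0).
case: gen => [[hp hq]|[n [hp hq /orP[l0|l0]]]].
(* With both operators of X-degree 0, the unreduced combination itself serves as [G]. *)
- left; exists (combination b p q); split; last exact: flat_degX_le0_combination.
  by rewrite -opprB ht; apply: in_idealN; exact: in_ideal_mulh.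
- right; exists p, n; split=> //; apply: Je => //; exact: in_ideal_comm_combination.
- right; exists q, n; split=> //; apply: Je => //; exact: in_ideal_comm_combination.
Qed.
End Relation.

(** * Both variables together, and the counting argument *)

Section SwapCombination.
Variables (A : comNzRingType) (d : biderivation A) (C : numFieldType).
Variables (ev : {rmorphism A -> C}) (iota : {rmorphism C -> A}) (u : A).
Hypothesis dx_iota : forall c, bdx d (iota c) = 0.
Hypothesis dy_iota : forall c, bdy d (iota c) = 0.
Hypothesis iotaK : forall c, ev (iota c) = c.
Local Notation D := (symb d).
Local Notation d' := (biderivation_swap d).
Local Notation h := (hsymb d u).
Local Notation J := (in_ideal (d := d) u).
Implicit Types (p q l : D).

Lemma swap_symb_combination K (b : 'I_K -> 'I_K -> C) p q : swap_symb (combination iota b p q) = combination iota b (swap_symb p) (swap_symb q).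
Proof.
rewrite /combination raddf_sum; apply: eq_bigr => r _; rewrite raddf_sum; apply: eq_bigr => s _ /=.
by rewrite swap_symb_scal rmorphM !rmorphXn.
Qed.
Lemma swap_symb_normal l : normal u l -> normal u (swap_symb l).
Proof. by move=> /swap_symb_in_ideal; rewrite swap_symb_comm swap_symb_hsymb. Qed.

Lemma flat_swap f : flat d' ev f -> flat d ev f.
Proof. by move=> hf n; have := vanishes_swap_symb (hf n); case: d. Qed.

(** The coefficient at [(0, 0)] belongs to the X-part and to the Y-part: the argument in X makes its
    y-derivative flat, the swapped argument its x-derivative, and its value is zero by
    assumption. *)
Lemma flatc_combination K (b : 'I_K -> 'I_K -> C) p q e :
  normal u p -> normal u q -> J (comm p q) -> reduced p -> reduced q ->
  generic ev p q -> generic ev (swap_symb p) (swap_symb q) ->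
  reduced e -> J (combination iota b p q - e) ->
  (forall i, ev (co e i 0) = 0) -> (forall j, ev (co e 0 j) = 0) -> flatc ev e.
Proof.
move=> np nq hpq rp rq gx gy re he ex ey.
have [hx fy] := flat_rows_combination dx_iota dy_iota np nq hpq rp rq gx re he ex.
have [] := @flat_rows_combination _ d' _ ev iota u dy_iota dx_iota K b (swap_symb p) (swap_symb q) (swap_symb e).
all: rewrite -?swap_symb_comm -?swap_symb_combination -?raddfB; try exact: swap_symb_normal; try exact: swap_symb_in_ideal; try exact: swap_symb_reduced; rewrite //.
  by move=> i; rewrite co_swap_symb.
move=> hy fx i j; case: i => [|i]; last exact: hx.
case: j => [|j]; last by have /flat_swap := hy j.+1 0%N isT; rewrite co_swap_symb.
move=> [|n]; first by split=> //; exact: ex.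
split; first exact: ex.
split; last exact: fy.
by have := flat_swap fx; rewrite co_swap_symb; exact.
Qed.

Lemma bound_exp N p n : bound N p -> bound (n * N).+1 (p ^+ n).
Proof.
move=> hp; elim: n => [|n IH]; first by move=> [|i] [|j] // _; rewrite expr0 co_mono.
by rewrite exprS mulSn -addnS; exact: bound_mul.
Qed.

(* Counting: monomials of degree below [K] in each operator number [K^2], while
   the pure coefficients of their reductions number only O(K), so some nonzero
   combination has all of its coefficients vanishing at the base point. *)
Lemma algebraic_relation (l1 l2 r1 r2 : D) :
  normal u l1 -> normal u l2 -> J (comm l1 l2) ->
  reduced r1 -> reduced r2 -> J (l1 - r1) -> J (l2 - r2) ->
  generic ev r1 r2 -> generic ev (swap_symb r1) (swap_symb r2) ->
  exists K (b : 'I_K -> 'I_K -> C) e, [/\ exists r s, b r s != 0, flatc ev e & J (combination iota b l1 l2 - e)].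
Proof.
move=> n1 n2 h12 rr1 rr2 h1 h2 gx gy.
have sub l r : l - (l - r) = r by rewrite opprB addrC subrK.
have [t1 ht1] := h1; have [t2 ht2] := h2.
have e1 : r1 = l1 - t1 * h by rewrite -ht1 sub.
have e2 : r2 = l2 - t2 * h by rewrite -ht2 sub.
have m1 : normal u r1 by rewrite /normal e1; apply: in_ideal_comm_sub => //; exact: normal_h.
have m2 : normal u r2 by rewrite /normal e2; apply: in_ideal_comm_sub => //; exact: normal_h.
have h12' : J (comm r1 r2).
  rewrite e1; apply: in_ideal_comm_sub => //; rewrite e2 comm_antisym; apply: in_idealN.
  by apply: in_ideal_comm_sub => //; rewrite comm_antisym; exact: in_idealN.
have [N1 b1] := bound_exists r1; have [N2 b2] := bound_exists r2.
pose N := maxn N1 N2.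
have c1 : bound N r1 by apply: boundW b1; exact: leq_maxl.
have c2 : bound N r2 by apply: boundW b2; exact: leq_maxr.
(* A monomial is bounded by [(r N + 1) + (s N + 1) <= B]. The value of [K] gives
   [K^2 - 4 K N = 5 K > 4], that is [K^2 > 2 B]. *)
pose K := (4 * N + 5)%N; pose B := (2 + 2 * K * N)%N.
have hB (rs : 'I_K * 'I_K) : bound B (r1 ^+ rs.1 * r2 ^+ rs.2).
  apply: boundW (bound_mul (bound_exp (n := rs.1) c1) (bound_exp (n := rs.2) c2)).
  have le (r : 'I_K) : (r * N <= K * N)%N by rewrite leq_mul2r ltnW ?orbT.
  by have := leq_add (le rs.1) (le rs.2); rewrite /B; lia.
have [E hE] := fin_all_exists (fun rs => reduction u (hB rs)).
(* One row per monomial; the columns are the pure X- and pure Y-coefficients of its reduction at the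
   base point. The constant coefficient occurs twice, which only adds a column. *)
pose M : 'M[C]_(#|{: 'I_K * 'I_K}|, B + B) := \matrix_(a, c)
  match fintype.split c with inl i => ev (co (E (enum_val a)) i 0) | inr j => ev (co (E (enum_val a)) 0 j) end.
have ltB : (B + B < #|{: 'I_K * 'I_K}|)%N.
  rewrite card_prod card_ord /B /K; nia.
have [v v0 vM] := nonzero_left_kernel M ltB.
pose b (r s : 'I_K) := v 0 (enum_rank (r, s)).
pose e : D := \sum_(r < K) \sum_(s < K) scal (iota (b r s)) (E (r, s)).
have eve i j : ev (co e i j) = \sum_a v 0 a * ev (co (E (enum_val a)) i j).
  rewrite [RHS](reindex (@enum_rank _)) /=; last exact/onW_bij/enum_rank_bij.
  under [RHS]eq_bigr => rs _ do rewrite enum_rankK.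
  transitivity (\sum_r \sum_s v 0 (enum_rank (r, s)) * ev (co (E (r, s)) i j)); last first.
    by rewrite pair_bigA; apply: eq_bigr => -[r s] _.
  rewrite co_sum rmorph_sum.
  apply: eq_bigr => r _; rewrite co_sum rmorph_sum; apply: eq_bigr => s _ /=.
  by rewrite co_scal rmorphM /= iotaK.
have bE : bound B e.
  move=> i j l; rewrite co_sum big1 // => r _; rewrite co_sum big1 // => s _.
  by rewrite co_scal; case: (hE (r, s)) => _ -> //; rewrite mulr0.
have vMc c : \sum_a v 0 a * M a c = 0 by have /rowP/(_ c) := vM; rewrite !mxE.
exists K, b, e.
have Je : J (combination iota b r1 r2 - e).
  rewrite -sumrB; apply: in_ideal_sum => r _; rewrite -sumrB; apply: in_ideal_sum => s _.
  rewrite -!mono00_mul -mulrBr; apply: in_idealMl.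
  by case: (hE (r, s)).
split.
- have [a va] : exists a, v 0 a != 0 by case/rV0Pn: v0 => a ?; exists a.
  by exists (enum_val a).1, (enum_val a).2; rewrite /b -surjective_pairing enum_valK.
- apply: (@flatc_combination K b r1 r2) => //.
  + move=> i j; rewrite co_sum big1 // => r _; rewrite co_sum big1 // => s _.
    by rewrite co_scal; case: (hE (r, s)) => -> _ _; rewrite mulr0.
  + move=> i; case: (ltnP i B) => l; last by rewrite bE ?l // rmorph0.
    rewrite eve -[RHS](vMc (lshift _ (Ordinal l))); apply: eq_bigr => a _.
    by rewrite mxE (unsplitK (inl (Ordinal l))).
  + move=> j; case: (ltnP j B) => l; last by rewrite bE ?l ?orbT // rmorph0.
    rewrite eve -[RHS](vMc (rshift _ (Ordinal l))); apply: eq_bigr => a _.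
    by rewrite mxE (unsplitK (inr (Ordinal l))).
- rewrite -[combination _ _ _ _](subrK (combination iota b r1 r2)) -addrA; apply: in_idealD => //.
  exact: in_ideal_combination_cong.
Qed.
End SwapCombination.

(** * Convergent double power series *)

Section Topology.
Variable R : realType.
Local Notation K := (CC R).
Local Notation K2 := (C2 R).

Lemma CC_ballE (x : K) (e : K) y : ball x e y = (`|x - y| < e).
Proof. by []. Qed.

Lemma CC_cvg_seq (s : nat -> K) l : s @ \oo --> l <->
  forall e : K, 0 < e -> exists N, forall n, (N <= n)%N -> `|l - s n| < e.
Proof.
split=> [h e e0|h].
  by have /cvg_ballP/(_ e e0) [N _ hN] := h; exists N => n /hN.
apply/cvg_ballP => e e0; have [N hN] := h e e0.
by exists N => // n /= /hN.
Qed.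

Lemma CC_open (U : set K2) : open U <->
  forall p, U p -> exists2 e : K, 0 < e & forall z, `|z.1 - p.1| < e -> `|z.2 - p.2| < e -> U z.
Proof.
rewrite openE; split=> h p /h.
  rewrite /interior => /nbhs_ballP [e /= e0 he]; exists e => // z z1 z2; apply: he.
  by split; rewrite CC_ballE distrC.
case=> e e0 he; apply/nbhs_ballP; exists e => // z [z1 z2]; apply: he.
  by rewrite distrC -CC_ballE.
by rewrite distrC -CC_ballE.
Qed.

Lemma real_gt0 (e : K) : 0 < e -> exists2 r : R, 0 < r & e = r%:C%C.
Proof.
case: e => a b; rewrite ltcE /= => /andP[/eqP b0 a0]; exists a => //.
by apply/eqP; rewrite eq_complex /= b0 !eqxx.
Qed.
Lemma real_ge0 (e : K) : 0 <= e -> exists2 r : R, 0 <= r & e = r%:C%C.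
Proof.
case: e => a b; rewrite lecE /= => /andP[/eqP b0 a0]; exists a => //.
by apply/eqP; rewrite eq_complex /= b0 !eqxx.
Qed.

Lemma pow_half_lt (M e : K) : 0 <= M -> 0 < e ->
  exists N, forall n, (N <= n)%N -> M * 2^-1 ^+ n < e.
Proof.
move=> /real_ge0 [m m0 ->] /real_gt0 [r r0 ->].
exists (Num.bound (m / r)).
move=> n hn; rewrite -[2](rmorph_nat (real_complex R)) -fmorphV -rmorphXn -rmorphM ltcR.
rewrite exprVn ltr_pdivrMr ?exprn_gt0 // mulrC -ltr_pdivrMr //.
apply: lt_le_trans (archi_boundP (divr_ge0 m0 (ltW r0))) _.
rewrite -natrX ler_nat; apply: leq_trans hn _; exact: ltnW (ltn_expl _ _).
Qed.

(** Replaces passages to the limit: estimates are proved with an error decaying in [n], which is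
    then dropped. *)
Lemma le_geom_lim (x c M : K) : 0 <= M -> (forall n, x <= c + M * 2^-1 ^+ n) -> x <= c.
Proof.
(* Complex numbers are only partially ordered; [x - c] is real because it is at most the real number
   [M]. *)
move=> M0 h; have hr : x - c \is Num.real.
  have /ler_real -> : x - c <= M by have := h 0%N; rewrite expr0 mulr1 addrC lerBlDr.
  exact: ger0_real.
rewrite -subr_le0; case: (real_ltgtP hr (real0 _)) => // lt.
have [N hN] := pow_half_lt M0 lt.
have := le_lt_trans (h N) (_ : c + M * 2^-1 ^+ N < c + (x - c)).
by rewrite ltrD2l hN // addrC subrK ltxx => /(_ isT).
Qed.

(** Completeness of the reals is applied to the real and imaginary parts, and the rate passes to the
    limit by [le_geom_lim]. *)
Lemma CC_complete (s : nat -> K) (M : K) : 0 <= M ->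
  (forall n m, (n <= m)%N -> `|s m - s n| <= M * 2^-1 ^+ n) ->
  exists l, forall n, `|l - s n| <= M * 2^-1 ^+ n.
Proof.
move=> M0 hs.
have cauchy (f : {additive K -> R}) : (forall z, (`|f z|%:C)%C <= `|z|) -> cvg ((f \o s) n @[n --> \oo]).
  move=> hf; apply/cauchy_cvgP/cauchy_exP => e e0.
  have e2 : 0 < (e%:C)%C :> K by rewrite ltcR.
  have [N hN] := pow_half_lt M0 e2.
  exists (f (s N)); exists N => // n /= Nn; rewrite /ball /= distrC -raddfB -ltcR.
  apply: le_lt_trans (hf _) _; apply: le_lt_trans (hs _ _ Nn) _; exact: hN.
have h1 : cvg (((@complex.Re R) \o s) n @[n --> \oo]).
  by apply: (cauchy (@complex.Re R)) => -[a b]; rewrite normc_def lecR /= -sqrtr_sqr ler_wsqrtr // lerDl sqr_ge0.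
have h2 : cvg (((@complex.Im R) \o s) n @[n --> \oo]).
  by apply: (cauchy (@complex.Im R)) => -[a b]; rewrite normc_def lecR /= -sqrtr_sqr ler_wsqrtr // lerDr sqr_ge0.
set a := lim _ in h1; set b := lim _ in h2.
exists (Complex a b) => n.
apply: (@le_geom_lim _ _ 1 ler01) => k; rewrite mul1r.
have k0 : 0 < (2^-1 ^+ k : R) / 2 by rewrite divr_gt0 // exprn_gt0 // invr_gt0.
have /cvgrPdist_lt/(_ _ k0) [N1 _ hN1] := h1.
have /cvgrPdist_lt/(_ _ k0) [N2 _ hN2] := h2.
pose m := maxn n (maxn N1 N2).
have {}hN1 := hN1 m _; have {}hN2 := hN2 m _.
rewrite -[Complex a b](subrK (s m)) -addrA addrC.
apply: le_trans (ler_normD _ _) _; apply: lerD; first by apply: hs; exact: leq_maxl.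
have -> : Complex a b - s m = ((a - complex.Re (s m))%:C + 'i%C * (b - complex.Im (s m))%:C)%C.
  by case: (s m) => c e; rewrite /=; simpc.
apply: le_trans (ler_normD _ _) _; rewrite normrM.
have -> : (2^-1 ^+ k : K) = ((2^-1 ^+ k / 2 + 2^-1 ^+ k / 2 : R)%:C)%C.
  by rewrite -splitr rmorphXn /= fmorphV /= rmorph_nat.
have nC (t : R) : `|(t%:C)%C : K| = (`|t|%:C)%C.
  by rewrite normc_def /= expr0n addr0 sqrtr_sqr.
rewrite !nC rmorphD /=; apply: lerD.
  by rewrite lecR ltW // hN1 //= /m !leq_max leqnn orbT.
have -> : `|'i%C : K| = 1 by rewrite normc_def /= expr0n expr1n add0r sqrtr1.
by rewrite mul1r lecR ltW // hN2 //= /m !leq_max leqnn !orbT.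
Qed.
End Topology.

(** * Square partial sums of double series *)

Section PowerSeries.
Variable F : numFieldType.
Implicit Types (a b : nat -> nat -> F) (x y rho : F).

Definition psum a n x y := \sum_(i < n) \sum_(j < n) a i j * x ^+ i * y ^+ j.
Definition absc a i j := `|a i j|.

Lemma le_psum a b n rho : 0 <= rho -> (forall i j, a i j <= b i j) ->
  psum a n rho rho <= psum b n rho rho.
Proof.
move=> r0 h; apply: ler_sum => i _; apply: ler_sum => j _.
by rewrite ler_wpM2r ?exprn_ge0 // ler_wpM2r ?exprn_ge0.
Qed.

Lemma psum_ge0 a n rho : 0 <= rho -> (forall i j, 0 <= a i j) -> 0 <= psum a n rho rho.
Proof.
move=> r0 h; apply: sumr_ge0 => i _; apply: sumr_ge0 => j _.
by rewrite !mulr_ge0 ?exprn_ge0.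
Qed.

Definition inbox n a i j := if (i < n)%N && (j < n)%N then a i j else 0.
Definition outbox n a i j := if (i < n)%N && (j < n)%N then 0 else a i j.

Lemma psum_inbox a n m x y : (n <= m)%N -> psum (inbox n a) m x y = psum a n x y.
Proof.
move=> nm; rewrite /psum [RHS](big_ord_widen _ (fun i => \sum_(j < n) a i j * x ^+ i * y ^+ j) nm).
rewrite [RHS]big_mkcond; apply: eq_bigr => i _; rewrite /inbox; case: ltnP => _ /=.
  rewrite [RHS](big_ord_widen _ (fun j => a i j * x ^+ i * y ^+ j) nm) [RHS]big_mkcond.
  by apply: eq_bigr => j _; case: ifP; rewrite ?mul0r.
by apply: big1 => j _; rewrite !mul0r.
Qed.

Lemma psumD a b n x y : psum (fun i j => a i j + b i j) n x y = psum a n x y + psum b n x y.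
Proof.
rewrite -big_split; apply: eq_bigr => i _; rewrite -big_split; apply: eq_bigr => j _.
by rewrite !mulrDl.
Qed.

Lemma psum_split a n m x y : (n <= m)%N -> psum a m x y = psum a n x y + psum (outbox n a) m x y.
Proof.
move=> nm; rewrite -(psum_inbox _ _ _ nm) -psumD; apply: eq_bigr => i _; apply: eq_bigr => j _.
by rewrite /inbox /outbox; case: ifP; rewrite ?addr0 ?add0r.
Qed.

Lemma norm_psum a n x y rho : `|x| <= rho -> `|y| <= rho ->
  `|psum a n x y| <= psum (absc a) n rho rho.
Proof.
move=> hx hy; apply: le_trans (ler_norm_sum _ _ _) _; apply: ler_sum => i _.
apply: le_trans (ler_norm_sum _ _ _) _; apply: ler_sum => j _.
rewrite !normrM !normrX; apply: ler_pM; rewrite ?mulr_ge0 ?exprn_ge0 //.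
  by apply: ler_wpM2l => //; apply: lerXn2r; rewrite ?nnegrE // (le_trans _ hx).
by apply: lerXn2r; rewrite ?nnegrE // (le_trans _ hy).
Qed.

Lemma half_ge0 : 0 <= 2^-1 :> F. Proof. by rewrite invr_ge0. Qed.
Lemma half_le1 : 2^-1 <= 1 :> F. Proof. by rewrite invf_le1 // ler1n. Qed.

(** Outside the square of side [n] one exponent is at least [n], so shrinking the radius by [t]
    gains a factor [t^n]. *)
Lemma psum_outbox a n m x y rho t : 0 <= rho -> 0 <= t -> t <= 1 ->
  `|x| <= rho * t -> `|y| <= rho * t ->
  `|psum (outbox n a) m x y| <= psum (absc a) m rho rho * t ^+ n.
Proof.
move=> r0 t0 t1 hx hy; apply: le_trans (norm_psum _ _ hx hy) _.
rewrite /psum mulr_suml; apply: ler_sum => i _; rewrite mulr_suml; apply: ler_sum => j _.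
rewrite /absc /outbox; case: ifP => [_|/negbT].
  by rewrite normr0 !mul0r !mulr_ge0 ?exprn_ge0.
rewrite negb_and -!leqNgt => hij.
rewrite !exprMn -!mulrA; apply: ler_wpM2l => //; apply: ler_wpM2l; first exact: exprn_ge0.
rewrite mulrCA; apply: ler_wpM2l; first exact: exprn_ge0.
rewrite -exprD; apply: ler_wiXn2l => //.
by case/orP: hij => h; rewrite (leq_trans h) ?leq_addr ?leq_addl.
Qed.

Lemma psum_tail a n m x y rho : 0 <= rho -> `|x| <= rho / 2 -> `|y| <= rho / 2 ->
  `|psum (outbox n a) m x y| <= psum (absc a) m rho rho * 2^-1 ^+ n.
Proof. by move=> r0; apply: psum_outbox; rewrite ?half_ge0 ?half_le1. Qed.

Lemma psum_diff a n m x y rho M : 0 <= rho -> `|x| <= rho / 2 -> `|y| <= rho / 2 ->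
  (forall k, psum (absc a) k rho rho <= M) -> (n <= m)%N ->
  `|psum a m x y - psum a n x y| <= M * 2^-1 ^+ n.
Proof.
move=> r0 hx hy hM nm; rewrite (psum_split _ _ _ nm) addrC addKr.
apply: le_trans (psum_tail _ _ _ r0 hx hy) _.
by apply: ler_wpM2r => //; rewrite exprn_ge0 ?half_ge0.
Qed.

Definition conv a b i j : F :=
  \sum_(k < i.+1) \sum_(l < j.+1) a k l * b (i - k)%N (j - l)%N.

(* Partial sums are evaluations of bivariate polynomials, whose product gives
   the Cauchy product up to terms outside the square of side [n]. *)
Definition bpoly n a : {poly {poly F}} := \poly_(i < n) \poly_(j < n) a i j.
Definition bhorner (p : {poly {poly F}}) x y := p.[x%:P].[y].

Lemma bhornerE (p : {poly {poly F}}) n x y : (forall i j, (n <= i)%N || (n <= j)%N -> p`_i`_j = 0) ->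
  bhorner p x y = psum (fun i j => p`_i`_j) n x y.
Proof.
move=> h; rewrite /bhorner (@horner_coef_wide _ n p); last first.
  by apply/leq_sizeP => i l; apply/polyP => j; rewrite h ?l // coef0.
rewrite horner_sum /psum; apply: eq_bigr => i _.
rewrite -polyC_exp hornerM hornerC (@horner_coef_wide _ n); last first.
  by apply/leq_sizeP => j l; rewrite h // l orbT.
by rewrite mulr_suml; apply: eq_bigr => j _; rewrite -!mulrA [y ^+ j * _]mulrC.
Qed.

Lemma coef_bpoly n a i j : (bpoly n a)`_i`_j = inbox n a i j.
Proof. by rewrite coef_poly /inbox; case: ltnP => _ /=; rewrite ?coef0 // coef_poly. Qed.

Lemma coef_bpolyM n a b i j :
  (bpoly n a * bpoly n b)`_i`_j = conv (inbox n a) (inbox n b) i j.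
Proof.
rewrite coefM coef_sum; apply: eq_bigr => k _; rewrite coefM; apply: eq_bigr => l _.
by rewrite !coef_bpoly.
Qed.

Lemma psumM a b n x y :
  psum a n x y * psum b n x y = psum (conv (inbox n a) (inbox n b)) (n + n) x y.
Proof.
have e c : psum c n x y = bhorner (bpoly n c) x y.
  rewrite (@bhornerE _ n) => [|i j l]; last first.
    by rewrite coef_bpoly /inbox; case: ifP l => // /andP[]; do 2!rewrite ltnNge => /negPf ->.
  rewrite -(psum_inbox c x y (leqnn n)); apply: eq_bigr => i _; apply: eq_bigr => j _.
  by rewrite coef_bpoly.
rewrite !e /bhorner -!hornerM (_ : _.[_].[_] = bhorner (bpoly n a * bpoly n b) x y) //.
rewrite (@bhornerE _ (n + n)) => [|i j l].
  by apply: eq_bigr => i _; apply: eq_bigr => j _; rewrite coef_bpolyM.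
rewrite coef_bpolyM /conv big1 // => k _; rewrite big1 // => s _.
rewrite /inbox; case: ifP => [/andP[kn sn]|]; rewrite ?mul0r //.
case: ifP => [/andP[kn' sn']|]; rewrite ?mulr0 //.
by move: l; lia.
Qed.

Lemma conv_inbox a b n i j : (i < n)%N -> (j < n)%N ->
  conv (inbox n a) (inbox n b) i j = conv a b i j.
Proof.
move=> hi hj; apply: eq_bigr => k _; apply: eq_bigr => l _; rewrite /inbox.
have kn : (k < n)%N by apply: leq_ltn_trans hi; rewrite -ltnS.
have ln : (l < n)%N by apply: leq_ltn_trans hj; rewrite -ltnS.
by rewrite kn ln !(leq_ltn_trans (leq_subr _ _)).
Qed.

Lemma abs_conv_le a b n i j :
  `|conv (inbox n a) (inbox n b) i j| <= conv (inbox n (absc a)) (inbox n (absc b)) i j.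
Proof.
apply: le_trans (ler_norm_sum _ _ _) _; apply: ler_sum => k _.
apply: le_trans (ler_norm_sum _ _ _) _; apply: ler_sum => l _.
by rewrite normrM /inbox /absc; apply: ler_pM => //; case: ifP; rewrite ?normr0.
Qed.

Lemma psum_abs_conv a b n rho M N : 0 <= rho ->
  (forall k, psum (absc a) k rho rho <= M) -> (forall k, psum (absc b) k rho rho <= N) ->
  psum (absc (conv (inbox n a) (inbox n b))) (n + n) rho rho <= M * N.
Proof.
move=> r0 hM hN.
apply: le_trans (_ : psum (conv (inbox n (absc a)) (inbox n (absc b))) (n + n) rho rho <= _).
  by apply: le_psum => // i j; exact: abs_conv_le.
by rewrite -psumM; apply: ler_pM => //; apply: psum_ge0 => // *; exact: normr_ge0.
Qed.

Lemma psum_conv_bound a b n rho M N : 0 <= rho ->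
  (forall k, psum (absc a) k rho rho <= M) -> (forall k, psum (absc b) k rho rho <= N) ->
  psum (absc (conv a b)) n rho rho <= M * N.
Proof.
move=> r0 hM hN; apply: le_trans (psum_abs_conv n r0 hM hN).
rewrite -(psum_inbox _ _ _ (leq_addr n n)); apply: le_psum => // i j.
rewrite /inbox; case: ifP => [/andP[hi hj]|_]; last exact: normr_ge0.
by rewrite /absc conv_inbox.
Qed.

Lemma psum_conv_diff a b n x y rho M N : 0 <= rho -> `|x| <= rho / 2 -> `|y| <= rho / 2 ->
  (forall k, psum (absc a) k rho rho <= M) -> (forall k, psum (absc b) k rho rho <= N) ->
  `|psum a n x y * psum b n x y - psum (conv a b) n x y| <= M * N * 2^-1 ^+ n.
Proof.
move=> r0 hx hy hM hN; rewrite psumM (psum_split _ _ _ (leq_addr n n)).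
have -> : psum (conv (inbox n a) (inbox n b)) n x y = psum (conv a b) n x y.
  by apply: eq_bigr => i _; apply: eq_bigr => j _; rewrite conv_inbox.
rewrite addrC addKr; apply: le_trans (psum_tail _ _ _ r0 hx hy) _.
by apply: ler_wpM2r; [rewrite exprn_ge0 ?half_ge0 | exact: psum_abs_conv].
Qed.

Definition dcoef a i j := a i.+1 j *+ i.+1.

(** The factor [i + 1] from termwise differentiation is absorbed by [4^-i], since [i < 4^i]; this is
    why the radius is divided by 4. *)
Lemma psum_dcoef_bound a n rho M : 0 < rho ->
  (forall k, psum (absc a) k rho rho <= M) ->
  psum (absc (dcoef a)) n (rho / 4) (rho / 4) <= M / rho.
Proof.
move=> r0 hM; rewrite ler_pdivlMr //; apply: le_trans (hM n.+1).
have r0' := ltW r0; have ab i j : 0 <= absc a i j by exact: normr_ge0.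
rewrite [leRHS]big_ord_recl /= ler_wpDl //.
  by apply: sumr_ge0 => j _; rewrite !mulr_ge0 ?exprn_ge0.
rewrite /psum mulr_suml; apply: ler_sum => i _; rewrite mulr_suml.
rewrite [leRHS]big_ord_recr /= ler_wpDr //.
  by rewrite !mulr_ge0 ?exprn_ge0.
apply: ler_sum => j _; rewrite /absc /dcoef normrMn.
have q0 : 0 <= 4^-1 :> F by rewrite invr_ge0.
have q1 : 4^-1 <= 1 :> F by rewrite invf_le1 // ler1n.
have i4 : (i.+1)%:R * 4^-1 ^+ i <= 1 :> F.
  rewrite exprVn ler_pdivrMr ?exprn_gt0 // mul1r -natrX ler_nat.
  exact: ltn_expl.
have -> : `|a i.+1 j| *+ i.+1 * (rho / 4) ^+ i * (rho / 4) ^+ j * rho =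
  (`|a i.+1 j| * rho ^+ i.+1 * rho ^+ j) * ((i.+1)%:R * 4^-1 ^+ i * 4^-1 ^+ j).
  rewrite -[_ *+ _]mulr_natr !exprMn exprS.
  by move: (`|a i.+1 j|) (rho ^+ i) (rho ^+ j) (4^-1 ^+ i) (4^-1 ^+ j) (i.+1%:R : F) => *; ring.
apply: ler_piMr; first by rewrite !mulr_ge0 ?exprn_ge0.
by apply: mulr_ile1 => //; rewrite ?exprn_ile1 ?mulr_ge0 ?exprn_ge0.
Qed.

(** The remainder satisfies [R_(i+1) = (x + h) R_i + i h^2 x^(i-1)]. The factor [s^2] avoids
    negative powers of [s], and the crude [4^i] survives the recursion because
    [4^i + i <= 4^(i+1)]. *)
Lemma pow_taylor1 (s x h : F) i : `|x| <= s -> `|x + h| <= s ->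
  `|(x + h) ^+ i - x ^+ i - h * (x ^+ i.-1 *+ i)| * s ^+ 2 <= `|h| ^+ 2 * (4 * s) ^+ i.
Proof.
move=> hx hxh; have s0 : 0 <= s by apply: le_trans hx.
elim: i => [|i IH]; first by rewrite !expr0 mulr0n mulr0 subr0 subrr normr0 mul0r mulr1 exprn_ge0.
set t := (x + h) ^+ i - x ^+ i - h * (x ^+ i.-1 *+ i) in IH.
have -> : (x + h) ^+ i.+1 - x ^+ i.+1 - h * (x ^+ i.+1.-1 *+ i.+1) =
    (x + h) * t + h ^+ 2 * (x ^+ i.-1 *+ i).
  rewrite /t /=; case: i {IH t} => [|i] /=; first by rewrite !expr1 !expr0 !mulr0n; ring.
  rewrite -[x ^+ i.+1 *+ _]mulr_natl -[x ^+ i *+ _]mulr_natl -[i.+2%:R]natr1 [(x + h) ^+ i.+2]exprS [x ^+ i.+2]exprS [x ^+ i.+1]exprS.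
  move: ((x + h) ^+ i.+1) (x ^+ i) (i.+1%:R : F) => a b m; ring.
have h1 : `|(x + h) * t| * s ^+ 2 <= s * (`|h| ^+ 2 * (4 * s) ^+ i).
  by rewrite normrM -mulrA; apply: ler_pM => //; rewrite mulr_ge0 ?exprn_ge0.
have h2 : `|h ^+ 2 * (x ^+ i.-1 *+ i)| * s ^+ 2 <= `|h| ^+ 2 * (i%:R * s ^+ i.+1).
  rewrite normrM normrX -mulrA; apply: ler_wpM2l; first exact: exprn_ge0.
  rewrite normrMn normrX; case: i {IH t h1} => [|i] /=; first by rewrite mulr0n !mul0r.
  rewrite -[_ *+ _]mulr_natl -mulrA; apply: ler_wpM2l => //.
  rewrite [in leRHS]exprS [in leRHS]exprS mulrA mulrC -expr2; apply: ler_wpM2l; first exact: exprn_ge0.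
  by apply: lerXn2r; rewrite ?nnegrE.
apply: le_trans (_ : (`|(x + h) * t| + `|h ^+ 2 * (x ^+ i.-1 *+ i)|) * s ^+ 2 <= _).
  by apply: ler_wpM2r; [exact: exprn_ge0 | exact: ler_normD].
rewrite mulrDl; apply: le_trans (lerD h1 h2) _.
have -> : s * (`|h| ^+ 2 * (4 * s) ^+ i) + `|h| ^+ 2 * (i%:R * s ^+ i.+1) =
  `|h| ^+ 2 * (s ^+ i.+1 * (4 ^+ i + i%:R)).
  by rewrite exprMn [s ^+ i.+1]exprS; move: (s ^+ i) (4 ^+ i) (i%:R : F) (`|h| ^+ 2) => *; ring.
apply: ler_wpM2l; first exact: exprn_ge0.
rewrite exprMn mulrC; apply: ler_wpM2r; first exact: exprn_ge0.
rewrite -!natrX -natrD ler_nat expnS; have := ltn_expl i (isT : 1 < 4)%N; lia.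
Qed.
End PowerSeries.

(** * Analytic functions as power series with a geometric rate *)

Section Analytic.
Variable R : realType.
Local Notation K := (CC R).
Local Notation K2 := (C2 R).
Implicit Types (p z : K2) (f g : K2 -> K) (a b : nat -> nat -> K) (rho M : K).

(* The geometric rate at half the radius replaces convergence of the partial
   sums; it follows from absolute summability at radius [rho]. *)
Definition pser p rho M a f :=
  [/\ 0 < rho, 0 <= M, forall n, psum (absc a) n rho rho <= M &
   forall z, `|z.1 - p.1| <= rho / 2 -> `|z.2 - p.2| <= rho / 2 ->
   forall n, `|f z - psum a n (z.1 - p.1) (z.2 - p.2)| <= M * 2^-1 ^+ n].
Definition analytic_at p f := exists rho M a, pser p rho M a f.

Lemma psum_mono a n (x y x' y' : K) : 0 <= x -> 0 <= y -> x <= x' -> y <= y' ->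
  psum (absc a) n x y <= psum (absc a) n x' y'.
Proof.
move=> x0 y0 xx yy; apply: ler_sum => i _; apply: ler_sum => j _.
have x0' := le_trans x0 xx; have y0' := le_trans y0 yy.
apply: ler_pM; rewrite ?mulr_ge0 ?exprn_ge0 ?normr_ge0 //.
  by apply: ler_wpM2l; rewrite ?normr_ge0 //; apply: lerXn2r.
exact: lerXn2r.
Qed.

Lemma half_lt (x : K) : 0 < x -> x / 2 < x.
Proof. by move=> x0; rewrite gtr_pMr // invf_lt1 // ltr1n. Qed.

Lemma analytic_onP (U : set K2) f : analytic_on U f <-> forall p, U p -> analytic_at p f.
Proof.
split=> h p /h; last first.
  case=> rho [M [a [r0 M0 hM hf]]]; exists (rho / 2); split; first by rewrite divr_gt0.
  exists a => z /ltW z1 /ltW z2; have r2 := ltW (half_lt r0); split.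
    exists M => n; apply: le_trans (hM n).
    by apply: psum_mono; rewrite ?normr_ge0 // ?(le_trans z1) ?(le_trans z2).
  apply/CC_cvg_seq => e e0; have [N hN] := pow_half_lt M0 e0.
  by exists N => n /hN; apply: le_lt_trans; exact: hf.
case=> r [r0 [a hz]]; pose rho := r / 2.
have rho0 : 0 < rho by rewrite divr_gt0.
have rr : `|rho| < r by rewrite ger0_norm ?half_lt // ltW.
have rr' (x : K) : `|x + rho - x| < r by rewrite addrC addKr.
(* The absolute sums are bounded point by point; the corner [p + (rho, rho)], inside the polydisc as
   [rho = r / 2], gives the bound at radius [rho]. *)
have [[M hM] _] := hz (p.1 + rho, p.2 + rho) (rr' _) (rr' _).
have {}hM n : psum (absc a) n rho rho <= M.
  by have := hM n; rewrite /= ![_ + rho]addrC !addrK ger0_norm // ltW.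
have M0 : 0 <= M by apply: le_trans (hM 0%N); rewrite /psum big_ord0.
exists rho, M, a; split=> // z z1 z2 n.
have lt2 : rho / 2 < r by apply: lt_trans (half_lt rho0) (half_lt r0).
have [_ /CC_cvg_seq hc] := hz z (le_lt_trans z1 lt2) (le_lt_trans z2 lt2).
apply: (@le_geom_lim _ _ _ 1 ler01) => k.
have k0 : 0 < 2^-1 ^+ k :> K by rewrite exprn_gt0 // invr_gt0.
have [N hN] := hc _ k0; have /ltW h1 := hN (maxn N n) (leq_maxl _ _).
rewrite -[f z](subrK (psum a (maxn N n) (z.1 - p.1) (z.2 - p.2))) -addrA addrC mul1r.
apply: le_trans (ler_normD _ _) _; apply: lerD; last exact: h1.
by apply: (psum_diff (ltW rho0) z1 z2 hM); exact: leq_maxr.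
Qed.

Lemma psum_center a n : psum a n.+1 0 0 = a 0%N 0%N.
Proof.
rewrite /psum big_ord_recl big_ord_recl /= !expr0 !mulr1 !big1 ?addr0 // => i _.
  by apply: big1 => j _; rewrite expr0n mulr0 mul0r.
by rewrite expr0n mulr0.
Qed.

Lemma pser_center p rho M a f : pser p rho M a f -> f p = a 0%N 0%N.
Proof.
case=> r0 M0 _ hf; have hp n := hf p _ _ n.
apply/eqP; rewrite -subr_eq0 -normr_le0; apply: (@le_geom_lim _ _ _ M M0) => n; rewrite add0r.
have := hf p; rewrite !subrr !normr0 => /(_ _ _ n.+1); rewrite psum_center => h.
have d0 : 0 <= rho / 2 by rewrite divr_ge0 ?ltW.
apply: le_trans (h d0 d0) _; apply: ler_wpM2l => //.
by apply: ler_wiXn2l; rewrite ?half_ge0 ?half_le1.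
Qed.

Lemma pser_shrink p rho rho' M a f g : 0 < rho' -> rho' <= rho ->
  (forall z, `|z.1 - p.1| <= rho' / 2 -> `|z.2 - p.2| <= rho' / 2 -> f z = g z) ->
  pser p rho M a f -> pser p rho' M a g.
Proof.
move=> r0' rr fg [r0 M0 hM hf]; split=> //.
  by move=> n; apply: le_trans (hM n); apply: psum_mono => //; exact: ltW.
move=> z z1 z2 n; rewrite -fg //; apply: hf; first apply: le_trans z1 _; last apply: le_trans z2 _.
  by rewrite ler_pM2r ?invr_gt0.
by rewrite ler_pM2r ?invr_gt0.
Qed.

Lemma pser_add p rho M N a b f g : pser p rho M a f -> pser p rho N b g ->
  pser p rho (M + N) (fun i j => a i j + b i j) (f \+ g).
Proof.
move=> [r0 M0 hM hf] [_ N0 hN hg]; split=> //; first exact: addr_ge0.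
  move=> n; apply: le_trans (lerD (hM n) (hN n)); rewrite -psumD; apply: le_psum; first exact: ltW.
  by move=> i j; exact: ler_normD.
move=> z z1 z2 n; rewrite psumD opprD addrACA mulrDl.
by apply: le_trans (ler_normD _ _) _; apply: lerD; [exact: hf | exact: hg].
Qed.

(** The factor 3 counts the errors: that of [g] times the bound of [f], that of [f] times the bound
    of [g], and the product terms outside the square. *)
Lemma pser_mul p rho M N a b f g : pser p rho M a f -> pser p rho N b g ->
  pser p rho (3 * (M * N)) (conv a b) (f \* g).
Proof.
move=> [r0 M0 hM hf] [_ N0 hN hg].
have MN : 0 <= M * N by rewrite mulr_ge0.
split=> //; first by rewrite mulr_ge0.
  move=> n; apply: le_trans (psum_conv_bound n (ltW r0) hM hN) _.
  by rewrite ler_peMl // ler1n.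
move=> z z1 z2 n /=; set x := z.1 - p.1 in z1 *; set y := z.2 - p.2 in z2 *.
have fM : `|f z| <= M by have := hf z z1 z2 0%N; rewrite /psum big_ord0 subr0 expr0 mulr1.
have bN : `|psum b n x y| <= N.
  apply: le_trans (norm_psum _ _ (le_trans z1 _) (le_trans z2 _)) (hN n); exact: ltW (half_lt r0).
have -> : f z * g z - psum (conv a b) n x y = f z * (g z - psum b n x y) +
   (f z - psum a n x y) * psum b n x y + (psum a n x y * psum b n x y - psum (conv a b) n x y) by ring.
have -> : 3 * (M * N) * 2^-1 ^+ n = M * (N * 2^-1 ^+ n) + (M * 2^-1 ^+ n) * N + M * N * 2^-1 ^+ n.
  by move: (2^-1 ^+ n) => ?; ring.
apply: le_trans (ler_normD _ _) _; apply: lerD; last exact: psum_conv_diff (ltW r0) z1 z2 hM hN.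
apply: le_trans (ler_normD _ _) _; rewrite !normrM; apply: lerD; apply: ler_pM => //.
  exact: hg.
exact: hf.
Qed.

Lemma pser_monomial1 p rho c : 0 < rho ->
  pser p rho `|c| (fun i j => if (i == 0%N) && (j == 0%N) then c else 0) (fun=> c).
Proof.
move=> r0; have e n x y : psum (fun i j => if (i == 0%N) && (j == 0%N) then c else 0) n.+1 x y = c :> K.
  rewrite /psum big_ord_recl big_ord_recl /= !expr0 !mulr1 !big1 ?addr0 // => i _.
    by apply: big1 => j _; rewrite !mul0r.
  by rewrite !mul0r.
split=> //.
  case=> [|n]; first by rewrite /psum big_ord0.
  rewrite /psum big_ord_recl big_ord_recl /= !expr0 !mulr1 !big1 ?addr0 // => i _.
    by apply: big1 => j _; rewrite /absc /= normr0 !mul0r.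
  by rewrite /absc /= normr0 !mul0r.
move=> z _ _ [|n]; first by rewrite /psum big_ord0 subr0 expr0 mulr1.
by rewrite e subrr normr0 mulr_ge0 // exprn_ge0 // half_ge0.
Qed.

Definition transpose_coef a i j : K := a j i.
Definition swap_pt z : K2 := (z.2, z.1).
Lemma psum_tr a n (x y : K) : psum (transpose_coef a) n y x = psum a n x y.
Proof.
rewrite /psum exchange_big; apply: eq_bigr => i _; apply: eq_bigr => j _.
by rewrite /transpose_coef mulrAC.
Qed.
Lemma pser_swap p rho M a f : pser p rho M a f -> pser (swap_pt p) rho M (transpose_coef a) (f \o swap_pt).
Proof.
move=> [r0 M0 hM hf]; split; [exact: r0 | exact: M0 | |].
  by move=> n; have -> : absc (transpose_coef a) = transpose_coef (absc a) by []; rewrite psum_tr; exact: hM.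
by move=> [z1 z2] /= h1 h2 n; rewrite psum_tr; apply: (hf (z2, z1)).
Qed.

Lemma CC_hausdorff : hausdorff_space K.
Proof. exact: (@norm_hausdorff _ (R[i])^o). Qed.

Lemma dX_cvg f z l (C r : K) : 0 < r -> 0 <= C ->
  (forall h, h != 0 -> `|h| <= r -> `|f (z.1 + h, z.2) - f z - h * l| <= C * `|h| ^+ 2) ->
  dX f z = l.
Proof.
move=> r0 C0 H; apply: cvg_lim; first exact: CC_hausdorff.
apply/cvg_ballP => e e0.
have C1 : 0 < C + 1 by rewrite ltr_wpDl.
have Ce : 0 < (C + 1) / e by rewrite divr_gt0.
(* A positive lower bound of [r] and [e / (C + 1)]: in a partial order, a parallel sum stands in for
   the minimum. *)
pose k := (r^-1 + (C + 1) / e)^-1.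
have k0 : 0 < k by rewrite invr_gt0 addr_gt0 // invr_gt0.
apply/nbhs_ballP; exists k => // h; rewrite CC_ballE sub0r normrN => hk h0.
have hk' : `|h| <= k := ltW hk.
have nh : 0 < `|h| by rewrite normr_gt0.
have hr : `|h| <= r.
  apply: le_trans hk' _; rewrite -[r in leRHS]invrK lef_pV2 ?posrE ?addr_gt0 ?invr_gt0 //.
  by rewrite lerDl ltW.
have he : `|h| * (C + 1) <= e.
  rewrite -ler_pdivlMr //; apply: le_trans hk' _.
  rewrite -[e / _]invf_div lef_pV2 ?posrE ?addr_gt0 ?invr_gt0 //.
  by rewrite lerDr invr_ge0 ltW.
rewrite CC_ballE distrC.
have -> : (f (z.1 + h, z.2) - f z) / h - l = (f (z.1 + h, z.2) - f z - h * l) / h.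
  by field.
rewrite normrM normfV ltr_pdivrMr //; apply: le_lt_trans (H h h0 hr) _.
rewrite expr2 mulrA ltr_pM2r //; apply: lt_le_trans he.
by rewrite mulrC ltr_pM2l // ltrDl.
Qed.

Lemma psum_taylor a n (x y h s M : K) : 0 < s -> `|x| <= s -> `|x + h| <= s -> `|y| <= 4 * s ->
  (forall k, psum (absc a) k (4 * s) (4 * s) <= M) ->
  `|psum a n (x + h) y - psum a n x y -
    h * \sum_(i < n) \sum_(j < n) a i j * (x ^+ i.-1 *+ i) * y ^+ j| <= M / s ^+ 2 * `|h| ^+ 2.
Proof.
move=> s0 hx hxh hy hM; have s0' := ltW s0.
have s40 : 0 <= 4 * s by rewrite mulr_ge0.
rewrite mulrAC ler_pdivlMr ?exprn_gt0 //.
apply: le_trans (_ : psum (absc a) n (4 * s) (4 * s) * `|h| ^+ 2 <= _); last first.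
  by apply: ler_wpM2r; rewrite ?exprn_ge0.
rewrite /psum mulr_sumr -!sumrB mulr_suml.
apply: le_trans (ler_wpM2r (exprn_ge0 2 s0') (ler_norm_sum _ _ _)) _.
rewrite mulr_suml; apply: ler_sum => i _.
rewrite mulr_sumr -!sumrB mulr_suml.
apply: le_trans (ler_wpM2r (exprn_ge0 2 s0') (ler_norm_sum _ _ _)) _.
rewrite mulr_suml; apply: ler_sum => j _.
have -> : a i j * (x + h) ^+ i * y ^+ j - a i j * x ^+ i * y ^+ j - h * (a i j * (x ^+ i.-1 *+ i) * y ^+ j)
   = a i j * ((x + h) ^+ i - x ^+ i - h * (x ^+ i.-1 *+ i)) * y ^+ j.
  by move: (x ^+ i) ((x + h) ^+ i) (x ^+ i.-1 *+ i) (y ^+ j) => *; ring.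
rewrite !normrM -!mulrA /absc; apply: ler_wpM2l => //.
rewrite [`|y ^+ j| * _]mulrC [leLHS]mulrA [leRHS]mulrA [leRHS]mulrAC; apply: ler_pM => //.
- by rewrite mulr_ge0 // exprn_ge0.
- by rewrite [leRHS]mulrC; exact: pow_taylor1.
- by rewrite normrX; apply: lerXn2r; rewrite ?nnegrE.
Qed.

(** The derivative is the limit [g] of the termwise differentiated sums. The increment of [f] is
    compared with [h * g] through partial sums, whose Taylor remainder is quadratic in [h] uniformly
    in [n]. *)
Lemma pser_dX p rho M a f : pser p rho M a f ->
  pser p (rho / 4) (M / rho) (dcoef a) (dX f).
Proof.
move=> [r0 M0 hM hf]; have r0' := ltW r0.
have s0 : 0 < rho / 4 by rewrite divr_gt0.
have Mr : 0 <= M / rho by rewrite divr_ge0.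
have hD n := psum_dcoef_bound n r0 hM.
split=> // z; set x := z.1 - p.1; set y := z.2 - p.2 => hx hy.
have hd n m : (n <= m)%N -> `|psum (dcoef a) m x y - psum (dcoef a) n x y| <= M / rho * 2^-1 ^+ n.
  by move=> nm; exact: (psum_diff (ltW s0) hx hy hD nm).
have [g hg] := CC_complete Mr hd.
have e48 : rho / 4 / 2 <= rho / 4 by apply/ltW/half_lt.
have e42 : rho / 4 <= rho / 2 by rewrite ler_pM2l // lef_pV2 ?posrE // ler_nat.
have e84 : rho / 4 / 2 + rho / 4 / 2 = rho / 4 by field.
suff -> : dX f z = g by [].
apply: (@dX_cvg f z g (M / (rho / 4) ^+ 2) (rho / 4 / 2)); first by rewrite divr_gt0.
  by rewrite divr_ge0 // exprn_ge0 // ltW.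
move=> h h0 hh.
have hxh : `|x + h| <= rho / 4.
  by rewrite -e84; apply: le_trans (ler_normD _ _) _; apply: lerD.
(* This constant collects the errors that decay with [n]: two for the values of [f], and two, with a
   factor [|h|], for the derivative sums. *)
have E0 : 0 <= M + M + (`|h| * (M / rho) + `|h| * (M / rho)).
  by have hm : 0 <= `|h| * (M / rho) := mulr_ge0 (normr_ge0 h) Mr; do !apply: addr_ge0.
apply: (le_geom_lim E0) => n.
pose P := \sum_(i < n.+1) \sum_(j < n.+1) a i j * (x ^+ i.-1 *+ i) * y ^+ j.
have ex : z.1 + h - p.1 = x + h by rewrite /x addrAC.
have t1 : `|f (z.1 + h, z.2) - psum a n.+1 (x + h) y| <= M * 2^-1 ^+ n.+1.
  by rewrite -ex; apply: hf; rewrite /= ?ex; [apply: le_trans hxh e42 | apply: le_trans hy (le_trans e48 e42)].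
have t2 : `|f z - psum a n.+1 x y| <= M * 2^-1 ^+ n.+1.
  by apply: hf; [apply: le_trans hx (le_trans e48 e42) | apply: le_trans hy (le_trans e48 e42)].
have e4 : 4 * (rho / 4) = rho by field.
have t3 : `|psum a n.+1 (x + h) y - psum a n.+1 x y - h * P| <= M / (rho / 4) ^+ 2 * `|h| ^+ 2.
  apply: psum_taylor => //; first by apply: le_trans hx e48.
    by rewrite e4; apply: le_trans hy (le_trans e48 (le_trans e42 (ltW (half_lt r0)))).
  by rewrite e4.
(* Differentiation shifts [i] but not [j], so [P] has [n] rows and [n.+1] columns; a zero row makes
   it square. *)
pose c i j := if (i < n)%N then dcoef a i j else 0.
have eP : P = psum c n.+1 x y.
  rewrite /P big_ord_recl /= big1 ?add0r => [|j _]; last by rewrite mulr0n mulr0 mul0r.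
  rewrite /psum big_ord_recr /= [X in _ + X]big1 ?addr0 => [|j _]; last by rewrite /c ltnn !mul0r.
  apply: eq_bigr => i _; apply: eq_bigr => j _; rewrite /c ltn_ord /dcoef /=.
  by rewrite mulrnAr !mulrnAl.
have t4 : `|P - psum (dcoef a) n x y| <= M / rho * 2^-1 ^+ n.
  rewrite eP (psum_split _ _ _ (leqnSn n)).
  have -> : psum c n x y = psum (dcoef a) n x y.
    by apply: eq_bigr => i _; apply: eq_bigr => j _; rewrite /c ltn_ord.
  rewrite addrC addKr; apply: le_trans (psum_tail _ _ _ (ltW s0) hx hy) _.
  apply: ler_wpM2r; first by rewrite exprn_ge0 // half_ge0.
  apply: le_trans (hD n.+1); apply: le_psum; first exact: ltW.
  by move=> i j; rewrite /absc /c; case: ifP; rewrite ?normr0.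
have t5 := hg n.
have -> : f (z.1 + h, z.2) - f z - h * g =
  (f (z.1 + h, z.2) - psum a n.+1 (x + h) y) - (f z - psum a n.+1 x y) +
  (psum a n.+1 (x + h) y - psum a n.+1 x y - h * P) +
  (h * (P - psum (dcoef a) n x y) - h * (g - psum (dcoef a) n x y)) by ring.
have hl : M * 2^-1 ^+ n.+1 <= M * 2^-1 ^+ n.
  by apply: ler_wpM2l => //; apply: ler_wiXn2l; rewrite ?half_ge0 ?half_le1.
have -> : M / (rho / 4) ^+ 2 * `|h| ^+ 2 + (M + M + (`|h| * (M / rho) + `|h| * (M / rho))) * 2^-1 ^+ n =
  (M * 2^-1 ^+ n + M * 2^-1 ^+ n) + M / (rho / 4) ^+ 2 * `|h| ^+ 2 +
   (`|h| * (M / rho * 2^-1 ^+ n) + `|h| * (M / rho * 2^-1 ^+ n)).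
  by move: (M / (rho / 4) ^+ 2 * _) (M / rho) (2^-1 ^+ n) => *; ring.
apply: le_trans (ler_normD _ _) _; apply: lerD.
  apply: le_trans (ler_normD _ _) _; apply: lerD => //.
  by apply: le_trans (ler_normB _ _) _; apply: lerD; [exact: le_trans t1 hl | exact: le_trans t2 hl].
by apply: le_trans (ler_normB _ _) _; rewrite !normrM; apply: lerD; apply: ler_wpM2l.
Qed.
End Analytic.

(** * Rules of calculus for analytic functions *)

Section AnalyticCalculus.
Variable R : realType.
Local Notation K := (CC R).
Local Notation K2 := (C2 R).
Implicit Types (p z : K2) (f g : K2 -> K) (a b : nat -> nat -> K) (rho M : K).

Lemma dY_swap f : dY f = dX (f \o @swap_pt R) \o @swap_pt R.
Proof. by apply/funext => -[z1 z2]. Qed.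

Definition dcoefY a : nat -> nat -> K := transpose_coef (dcoef (transpose_coef a)).
Lemma pser_dY p rho M a f : pser p rho M a f -> pser p (rho / 4) (M / rho) (dcoefY a) (dY f).
Proof.
move=> /pser_swap/pser_dX/pser_swap; rewrite dY_swap; by case: p.
Qed.

Lemma min_pos (r s : K) : 0 < r -> 0 < s -> exists t, [/\ 0 < t, t <= r & t <= s].
Proof.
move=> r0 s0; exists (r^-1 + s^-1)^-1.
have h : 0 < r^-1 + s^-1 by rewrite addr_gt0 ?invr_gt0.
split; first by rewrite invr_gt0.
- by rewrite -[leRHS]invrK lef_pV2 ?posrE ?invr_gt0 // lerDl invr_ge0 ltW.
- by rewrite -[leRHS]invrK lef_pV2 ?posrE ?invr_gt0 // lerDr invr_ge0 ltW.
Qed.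

Lemma pser_common p f g : analytic_at p f -> analytic_at p g ->
  exists rho M N a b, pser p rho M a f /\ pser p rho N b g.
Proof.
move=> [r [M [a hf]]] [s [N [b hg]]].
have [t [t0 tr ts]] : exists t, [/\ 0 < t, t <= r & t <= s].
  by case: hf => r0 _ _ _; case: hg => s0 _ _ _; exact: min_pos.
exists t, M, N, a, b; split.
  exact: (pser_shrink t0 tr (fun _ _ _ => erefl) hf).
exact: (pser_shrink t0 ts (fun _ _ _ => erefl) hg).
Qed.

Definition near_eq p f g := exists2 e : K, 0 < e &
  forall z, `|z.1 - p.1| < e -> `|z.2 - p.2| < e -> f z = g z.

Lemma pser_near_eq p f g : analytic_at p f -> near_eq p f g ->
  exists rho M a, pser p rho M a f /\ pser p rho M a g.
Proof.
move=> [r [M [a hf]]] [e e0 he].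
have [t [t0 tr te]] : exists t, [/\ 0 < t, t <= r & t <= e].
  by case: hf => r0 _ _ _; exact: min_pos.
exists t, M, a; split.
  exact: (pser_shrink t0 tr (fun _ _ _ => erefl) hf).
apply: (pser_shrink t0 tr _ hf) => z z1 z2; apply: he.
  by apply: le_lt_trans z1 _; apply: lt_le_trans (half_lt t0) te.
by apply: le_lt_trans z2 _; apply: lt_le_trans (half_lt t0) te.
Qed.

Lemma near_eq_analytic p f g : analytic_at p f -> near_eq p f g -> analytic_at p g.
Proof. by move=> hf hg; have [r [M [a [_ h]]]] := pser_near_eq hf hg; exists r, M, a. Qed.

Lemma pser_dXE p rho M a f : pser p rho M a f -> dX f p = a 1%N 0%N.
Proof. by move=> /pser_dX/pser_center ->. Qed.
Lemma pser_dYE p rho M a f : pser p rho M a f -> dY f p = a 0%N 1%N.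
Proof. by move=> /pser_dY/pser_center ->. Qed.

Lemma near_eq_dX p f g : analytic_at p f -> near_eq p f g -> dX f p = dX g p.
Proof.
by move=> hf hg; have [r [M [a [h1 h2]]]] := pser_near_eq hf hg; rewrite (pser_dXE h1) (pser_dXE h2).
Qed.
Lemma near_eq_dY p f g : analytic_at p f -> near_eq p f g -> dY f p = dY g p.
Proof.
by move=> hf hg; have [r [M [a [h1 h2]]]] := pser_near_eq hf hg; rewrite (pser_dYE h1) (pser_dYE h2).
Qed.

Lemma analytic_dX p f : analytic_at p f -> analytic_at p (dX f).
Proof. by move=> [r [M [a /pser_dX h]]]; do 3!eexists; exact: h. Qed.
Lemma analytic_dY p f : analytic_at p f -> analytic_at p (dY f).
Proof. by move=> [r [M [a /pser_dY h]]]; do 3!eexists; exact: h. Qed.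
Lemma analytic_add p f g : analytic_at p f -> analytic_at p g -> analytic_at p (f \+ g).
Proof.
by move=> hf hg; have [r [M [N [a [b [h1 h2]]]]]] := pser_common hf hg; do 3!eexists; exact: pser_add h1 h2.
Qed.
Lemma analytic_mul p f g : analytic_at p f -> analytic_at p g -> analytic_at p (f \* g).
Proof.
by move=> hf hg; have [r [M [N [a [b [h1 h2]]]]]] := pser_common hf hg; do 3!eexists; exact: pser_mul h1 h2.
Qed.
Lemma analytic_cst p (c : K) : analytic_at p (fun=> c).
Proof. by do 3!eexists; exact: (pser_monomial1 p c ltr01). Qed.

Lemma dX_add p f g : analytic_at p f -> analytic_at p g -> dX (f \+ g) p = dX f p + dX g p.
Proof.
move=> hf hg; have [r [M [N [a [b [h1 h2]]]]]] := pser_common hf hg.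
by rewrite (pser_dXE h1) (pser_dXE h2) (pser_dXE (pser_add h1 h2)).
Qed.
Lemma dY_add p f g : analytic_at p f -> analytic_at p g -> dY (f \+ g) p = dY f p + dY g p.
Proof.
move=> hf hg; have [r [M [N [a [b [h1 h2]]]]]] := pser_common hf hg.
by rewrite (pser_dYE h1) (pser_dYE h2) (pser_dYE (pser_add h1 h2)).
Qed.
Lemma dX_mul p f g : analytic_at p f -> analytic_at p g ->
  dX (f \* g) p = dX f p * g p + f p * dX g p.
Proof.
move=> hf hg; have [r [M [N [a [b [h1 h2]]]]]] := pser_common hf hg.
rewrite (pser_dXE h1) (pser_dXE h2) (pser_dXE (pser_mul h1 h2)) (pser_center h1) (pser_center h2).
by rewrite /conv !big_ord_recl !big_ord0 /= !addr0 addrC.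
Qed.
Lemma dY_mul p f g : analytic_at p f -> analytic_at p g ->
  dY (f \* g) p = dY f p * g p + f p * dY g p.
Proof.
move=> hf hg; have [r [M [N [a [b [h1 h2]]]]]] := pser_common hf hg.
rewrite (pser_dYE h1) (pser_dYE h2) (pser_dYE (pser_mul h1 h2)) (pser_center h1) (pser_center h2).
by rewrite /conv !big_ord_recl !big_ord0 /= !addr0 addrC.
Qed.
Lemma dX_dY p f : analytic_at p f -> dX (dY f) p = dY (dX f) p.
Proof.
move=> [r [M [a h]]].
by rewrite (pser_dXE (pser_dY h)) (pser_dYE (pser_dX h)).
Qed.
Lemma dX_cst p (c : K) : dX (fun=> c) p = 0.
Proof. by rewrite (pser_dXE (pser_monomial1 p c ltr01)). Qed.
Lemma dY_cst p (c : K) : dY (fun=> c) p = 0.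
Proof. by rewrite (pser_dYE (pser_monomial1 p c ltr01)). Qed.

Definition coef10 (i j : nat) : K := if (i == 1%N) && (j == 0%N) then 1 else 0.
Lemma pser_fst p : pser p 1 1 coef10 (fun z => z.1 - p.1).
Proof.
have e n x y : psum coef10 n.+2 x y = x.
  have -> : coef10 = inbox 2 coef10.
    by apply/funext => -[|[|i]]; apply/funext => -[|[|j]]; rewrite /inbox /coef10 ?andbF.
  rewrite psum_inbox // /psum !big_ord_recl !big_ord0 /= /coef10 /=.
  by rewrite !expr0 !expr1 !mul0r !mul1r !mulr1 !addr0 !add0r.
have e1 x y : psum coef10 1 x y = 0.
  by rewrite /psum !big_ord_recl !big_ord0 /coef10 /= !mul0r !addr0.
have eA : absc coef10 = coef10.
  by apply/funext => i; apply/funext => j; rewrite /absc /coef10; case: ifP; rewrite ?normr1 ?normr0.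
split=> // [[|[|n]]|z z1 _ [|[|n]]].
- by rewrite /psum big_ord0.
- by rewrite eA e1.
- by rewrite eA e.
- rewrite /psum big_ord0 subr0 expr0 mulr1; apply: le_trans z1 _.
  by rewrite mul1r half_le1.
- by rewrite e1 subr0 expr1.
- by rewrite e subrr normr0 mul1r exprn_ge0 // half_ge0.
Qed.
Lemma pser_snd p : pser p 1 1 (transpose_coef coef10) (fun z => z.2 - p.2).
Proof. by have := pser_swap (pser_fst (swap_pt p)); case: p. Qed.

Lemma near_eq0_of_coef p rho M a f : pser p rho M a f -> (forall i j, a i j = 0) ->
  near_eq p f (fun=> 0).
Proof.
move=> [r0 M0 hM hf] a0; exists (rho / 2); first by rewrite divr_gt0.
move=> z /ltW z1 /ltW z2; apply/eqP; rewrite -normr_le0.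
apply: (le_geom_lim M0) => n; rewrite add0r; have := hf z z1 z2 n.
suff -> : psum a n (z.1 - p.1) (z.2 - p.2) = 0 by rewrite subr0.
by rewrite /psum big1 // => i _; rewrite big1 // => j _; rewrite a0 !mul0r.
Qed.

Lemma nonzero_near p f : analytic_at p f -> f p != 0 ->
  exists2 e : K, 0 < e & forall z, `|z.1 - p.1| < e -> `|z.2 - p.2| < e -> f z != 0.
Proof.
move=> [rho [M [a h]]] fp; have fpE := pser_center h; case: h => r0 M0 hM hf.
have fp0 : 0 < `|f p| by rewrite normr_gt0.
have M1 : 0 < M + 1 by rewrite ltr_wpDl.
have h2 : 0 < 2^-1 :> K by rewrite invr_gt0.
(* [t <= 1/2] keeps the points where the series represents [f], and [t <= |f p| / (M + 1)] makes the
   variation [M t] smaller than [|f p|]. *)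
have [t [t0 th tM]] := min_pos h2 (divr_gt0 fp0 M1).
exists (rho * t) => [|z /ltW z1 /ltW z2]; first by rewrite mulr_gt0.
have t1 := le_trans th (half_le1 K).
have zb (w : K) : w <= rho * t -> w <= rho / 2.
  by move=> h; apply: le_trans h _; apply: ler_wpM2l => //; exact: ltW.
suff h : `|f z - f p| < `|f p|.
  by apply/eqP => fz; move: h; rewrite fz sub0r normrN ltxx.
apply: (@le_lt_trans _ _ (M * t)); last first.
  apply: (@lt_le_trans _ _ ((M + 1) * t)); first by rewrite ltr_pM2r // ltrDl.
  by rewrite mulrC -ler_pdivlMr.
apply: (le_geom_lim M0) => n.
rewrite -[f z](subrK (psum a n.+1 (z.1 - p.1) (z.2 - p.2))) -addrA addrC.
apply: le_trans (ler_normD _ _) _; apply: lerD; last first.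
  apply: le_trans (hf z (zb _ z1) (zb _ z2) n.+1) _; apply: ler_wpM2l => //.
  by apply: ler_wiXn2l; rewrite ?half_ge0 ?half_le1.
rewrite (@psum_split _ a 1 n.+1 _ _ isT) {1}/psum !big_ord_recl !big_ord0 /= !expr0 !mulr1 !addr0 -fpE.
rewrite addrC addKr.
apply: le_trans (psum_outbox _ _ _ (ltW r0) (ltW t0) t1 z1 z2) _.
by rewrite expr1; apply: ler_wpM2r => //; exact: ltW.
Qed.
End AnalyticCalculus.

(** * The differential ring of analytic functions on a region *)

(** The point [rpt] makes the region nonempty, so that [1 != 0] in its ring of functions. *)
Record region (R : realType) := Region {
  rset : set (C2 R);
  rpt : C2 R;
  rpt_in : rset rpt;
  ropen : open rset }.

(* Functions analytic on the region, extended by 0 outside of it so that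
   equality on the region is Leibniz equality. *)
Record holo (R : realType) (D : region R) := Holo {
  hval : C2 R -> CC R;
  hval_an : forall p, rset D p -> analytic_at p hval;
  hval_out : forall p, ~ rset D p -> hval p = 0 }.

HB.instance Definition _ (R : realType) (D : region R) := gen_eqMixin (holo D).
HB.instance Definition _ (R : realType) (D : region R) := gen_choiceMixin (holo D).

Section HoloRing.
Variables (R : realType) (D : region R).
Local Notation K := (CC R).
Local Notation K2 := (C2 R).
Local Notation U := (rset D).
Local Notation O := (holo D).
Implicit Types (f g : O) (phi : K2 -> K).

Lemma holo_eq f g : (forall z, U z -> hval f z = hval g z) -> f = g.
Proof.
case: f => f fa fo; case: g => g ga go /= h.
have e : f = g.
  by apply/funext => z; have [Uz|Uz] := pselect (U z); [exact: h | rewrite fo // go].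
by subst g; congr Holo; exact: Prop_irrelevance.
Qed.

Lemma near_eq_region p phi psi : U p -> (forall z, U z -> phi z = psi z) -> near_eq p phi psi.
Proof.
move=> Up h; have [e e0 he] := (proj1 (CC_open U) (@ropen _ D)) p Up.
by exists e => // z z1 z2; apply: h; exact: he.
Qed.

Definition trunc phi : K2 -> K := fun z => if pselect (U z) then phi z else 0.
Lemma truncE phi z : U z -> trunc phi z = phi z.
Proof. by rewrite /trunc; case: pselect. Qed.
Lemma trunc_an phi : (forall p, U p -> analytic_at p phi) -> forall p, U p -> analytic_at p (trunc phi).
Proof.
move=> h p Up; apply: (near_eq_analytic (h p Up)).
by apply: near_eq_region => // z Uz; rewrite truncE.
Qed.
Lemma trunc_out phi p : ~ U p -> trunc phi p = 0.
Proof. by rewrite /trunc; case: pselect. Qed.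

Lemma cst0_an p : U p -> analytic_at p (fun=> 0 : K).
Proof. by move=> _; exact: analytic_cst. Qed.

(** Non-analytic functions are sent to 0, so that the operations can be defined before analyticity
    of their results is proved. *)
Definition to_holo phi : O :=
  match pselect (forall p, U p -> analytic_at p phi) with
  | left h => Holo (trunc_an h) (@trunc_out phi)
  | right _ => Holo (trunc_an cst0_an) (@trunc_out (fun=> 0))
  end.
Lemma to_holoE phi z : (forall p, U p -> analytic_at p phi) -> U z -> hval (to_holo phi) z = phi z.
Proof. by move=> h Uz; rewrite /to_holo; case: pselect => // h' /=; rewrite truncE. Qed.

Local Opaque to_holo dX dY.

Definition hadd f g := to_holo (hval f \+ hval g).
Definition hmul f g := to_holo (hval f \* hval g).
Definition hcst (c : K) := to_holo (fun=> c).
Definition hopp f := hmul (hcst (-1)) f.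
Definition hdx f := to_holo (dX (hval f)).
Definition hdy f := to_holo (dY (hval f)).

Lemma haddE f g z : U z -> hval (hadd f g) z = hval f z + hval g z.
Proof. by move=> Uz; rewrite to_holoE // => p Up; apply: analytic_add; exact: hval_an. Qed.
Lemma hmulE f g z : U z -> hval (hmul f g) z = hval f z * hval g z.
Proof. by move=> Uz; rewrite to_holoE // => p Up; apply: analytic_mul; exact: hval_an. Qed.
Lemma hcstE c z : U z -> hval (hcst c) z = c.
Proof. by move=> Uz; rewrite to_holoE // => p Up; exact: analytic_cst. Qed.
Lemma hoppE f z : U z -> hval (hopp f) z = - hval f z.
Proof. by move=> Uz; rewrite hmulE // hcstE // mulN1r. Qed.
Lemma hdxE f z : U z -> hval (hdx f) z = dX (hval f) z.
Proof. by move=> Uz; rewrite to_holoE // => p Up; apply: analytic_dX; exact: hval_an. Qed.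
Lemma hdyE f z : U z -> hval (hdy f) z = dY (hval f) z.
Proof. by move=> Uz; rewrite to_holoE // => p Up; apply: analytic_dY; exact: hval_an. Qed.

Lemma haddA : associative hadd.
Proof. by move=> f g h; apply: holo_eq => z Uz; rewrite !haddE // addrA. Qed.
Lemma haddC : commutative hadd.
Proof. by move=> f g; apply: holo_eq => z Uz; rewrite !haddE // addrC. Qed.
Lemma hadd0 : left_id (hcst 0) hadd.
Proof. by move=> f; apply: holo_eq => z Uz; rewrite haddE // hcstE // add0r. Qed.
Lemma haddN : left_inverse (hcst 0) hopp hadd.
Proof. by move=> f; apply: holo_eq => z Uz; rewrite haddE // hcstE // hoppE // addNr. Qed.
HB.instance Definition _ := GRing.isZmodule.Build O haddA haddC hadd0 haddN.
Lemma hmulA : associative hmul.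
Proof. by move=> f g h; apply: holo_eq => z Uz; rewrite !hmulE // mulrA. Qed.
Lemma hmulC : commutative hmul.
Proof. by move=> f g; apply: holo_eq => z Uz; rewrite !hmulE // mulrC. Qed.
Lemma hmul1 : left_id (hcst 1) hmul.
Proof. by move=> f; apply: holo_eq => z Uz; rewrite hmulE // hcstE // mul1r. Qed.
Lemma hmulD : left_distributive hmul hadd.
Proof.
by move=> f g h; apply: holo_eq => z Uz; rewrite hmulE // !haddE // !hmulE // mulrDl.
Qed.
Lemma h1_neq0 : hcst 1 != 0 :> O.
Proof.
apply/eqP => /(congr1 (fun f => hval f (rpt D))).
rewrite !hcstE; try exact: rpt_in.
by move=> /eqP; rewrite oner_eq0.
Qed.
HB.instance Definition _ := GRing.Zmodule_isComNzRing.Build O hmulA hmulC hmul1 hmulD h1_neq0.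

Lemma hval0 z : hval (0 : O) z = 0.
Proof.
have [Uz|Uz] := pselect (U z); first exact: hcstE.
exact: hval_out.
Qed.
Lemma hvalD f g z : hval (f + g) z = hval f z + hval g z.
Proof.
have [Uz|Uz] := pselect (U z); first exact: haddE.
by rewrite !hval_out // addr0.
Qed.
Lemma hvalN f z : hval (- f) z = - hval f z.
Proof.
have [Uz|Uz] := pselect (U z); first exact: hoppE.
by rewrite !hval_out // oppr0.
Qed.
Lemma hvalB f g z : hval (f - g) z = hval f z - hval g z.
Proof. by rewrite hvalD hvalN. Qed.
Lemma hvalM f g z : hval (f * g) z = hval f z * hval g z.
Proof.
have [Uz|Uz] := pselect (U z); first exact: hmulE.
by rewrite !hval_out // mulr0.
Qed.
Lemma hval_sum I r (P : pred I) (F : I -> O) z :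
  hval (\sum_(i <- r | P i) F i) z = \sum_(i <- r | P i) hval (F i) z.
Proof. by apply: (big_morph (fun f => hval f z)) => [f g|]; rewrite ?hvalD ?hval0. Qed.
Lemma hval1 z : U z -> hval (1 : O) z = 1.
Proof. exact: hcstE. Qed.

Lemma hdx_near f psi p : U p -> (forall z, U z -> hval f z = psi z) -> dX psi p = dX (hval f) p.
Proof.
move=> Up h; apply/esym/near_eq_dX; first exact: hval_an.
exact: near_eq_region.
Qed.
Lemma hdy_near f psi p : U p -> (forall z, U z -> hval f z = psi z) -> dY psi p = dY (hval f) p.
Proof.
move=> Up h; apply/esym/near_eq_dY; first exact: hval_an.
exact: near_eq_region.
Qed.

Lemma hdxD f g : hdx (f + g) = hdx f + hdx g.
Proof.
apply: holo_eq => z Uz; rewrite hvalD !hdxE //.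
rewrite -(hdx_near Uz (psi := hval f \+ hval g)) => [|w Uw]; last exact: hvalD.
by rewrite dX_add //; exact: hval_an.
Qed.
Lemma hdyD f g : hdy (f + g) = hdy f + hdy g.
Proof.
apply: holo_eq => z Uz; rewrite hvalD !hdyE //.
rewrite -(hdy_near Uz (psi := hval f \+ hval g)) => [|w Uw]; last exact: hvalD.
by rewrite dY_add //; exact: hval_an.
Qed.
Lemma hdxM f g : hdx (f * g) = hdx f * g + f * hdx g.
Proof.
apply: holo_eq => z Uz; rewrite hvalD !hvalM !hdxE //.
rewrite -(hdx_near Uz (psi := hval f \* hval g)) => [|w Uw]; last exact: hvalM.
by rewrite dX_mul //; exact: hval_an.
Qed.
Lemma hdyM f g : hdy (f * g) = hdy f * g + f * hdy g.
Proof.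
apply: holo_eq => z Uz; rewrite hvalD !hvalM !hdyE //.
rewrite -(hdy_near Uz (psi := hval f \* hval g)) => [|w Uw]; last exact: hvalM.
by rewrite dY_mul //; exact: hval_an.
Qed.
Lemma hdxyC f : hdx (hdy f) = hdy (hdx f).
Proof.
apply: holo_eq => z Uz.
have e1 : dX (dY (hval f)) z = dX (hval (hdy f)) z by apply: hdx_near => // w Uw; exact: hdyE.
have e2 : dY (dX (hval f)) z = dY (hval (hdx f)) z by apply: hdy_near => // w Uw; exact: hdxE.
apply: (etrans (hdxE (hdy f) Uz)); apply: (etrans (esym e1)).
apply: (etrans (dX_dY (hval_an f Uz))); apply: (etrans e2); exact: esym (hdyE (hdx f) Uz).
Qed.
Lemma hdxB : additive hdx.
Proof.
by move=> f g; apply: (addIr (hdx g)); rewrite -hdxD !subrK.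
Qed.
Lemma hdyB : additive hdy.
Proof.
by move=> f g; apply: (addIr (hdy g)); rewrite -hdyD !subrK.
Qed.
HB.instance Definition _ := GRing.isZmodMorphism.Build O O hdx hdxB.
HB.instance Definition _ := GRing.isZmodMorphism.Build O O hdy hdyB.
Definition holo_der : biderivation O := Biderivation hdxM hdyM hdxyC.

Lemma hcst_add : additive hcst.
Proof. by move=> c e; apply: holo_eq => z Uz; rewrite hvalB !hcstE. Qed.
Lemma hcst_mul : monoid_morphism hcst.
Proof. by split=> // c e; apply: holo_eq => z Uz; rewrite hvalM !hcstE. Qed.
HB.instance Definition _ := GRing.isZmodMorphism.Build K O hcst hcst_add.
HB.instance Definition _ := GRing.isMonoidMorphism.Build K O hcst hcst_mul.
Lemma hdx_cst c : hdx (hcst c) = 0.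
Proof.
apply: holo_eq => z Uz; rewrite hdxE // -(hdx_near Uz (psi := fun=> c)) => [|w Uw]; last exact: hcstE.
by rewrite dX_cst hval0.
Qed.
Lemma hdy_cst c : hdy (hcst c) = 0.
Proof.
apply: holo_eq => z Uz; rewrite hdyE // -(hdy_near Uz (psi := fun=> c)) => [|w Uw]; last exact: hcstE.
by rewrite dY_cst hval0.
Qed.

(** The membership proof is an argument because evaluation sends 1 to 1 only at points of the
    region. *)
Definition evat p (Up : U p) f := hval f p.
Lemma evat_add p (Up : U p) : additive (evat Up).
Proof. by move=> f g; exact: hvalB. Qed.
Lemma evat_mul p (Up : U p) : monoid_morphism (evat Up).
Proof. by split=> [|f g]; [exact: hval1 | exact: hvalM]. Qed.
HB.instance Definition _ p (Up : U p) := GRing.isZmodMorphism.Build O K (evat Up) (evat_add Up).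
HB.instance Definition _ p (Up : U p) := GRing.isMonoidMorphism.Build O K (evat Up) (evat_mul Up).

Lemma near_eq0_dX phi p : near_eq p phi (fun=> 0) -> near_eq p (dX phi) (fun=> 0).
Proof.
case=> e e0 h; exists e => // z z1 z2.
rewrite -(dX_cst z 0); apply/esym/near_eq_dX; first exact: analytic_cst.
have [r r0 rb] : exists2 r : K, 0 < r & `|z.1 - p.1| + r <= e /\ `|z.2 - p.2| + r <= e.
  have a1 : 0 < e - `|z.1 - p.1| by rewrite subr_gt0.
  have a2 : 0 < e - `|z.2 - p.2| by rewrite subr_gt0.
  have [t [t0 t1 t2]] := min_pos a1 a2.
  by exists t => //; rewrite ![_ + t]addrC -!lerBrDr.
have tri (a b c : K) : `|a - b| < r -> `|b - c| + r <= e -> `|a - c| < e.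
  move=> h1 h2; apply: lt_le_trans h2; rewrite -[a](subrK b) -addrA.
  by apply: le_lt_trans (ler_normD _ _) _; rewrite [_ + r]addrC ltrD2r.
by case: rb => r1 r2; exists r => // w w1 w2; rewrite h //; [exact: tri w1 r1 | exact: tri w2 r2].
Qed.
Lemma near_eq0_dY phi p : near_eq p phi (fun=> 0) -> near_eq p (dY phi) (fun=> 0).
Proof.
case=> e e0 h; have [|d d0 hd] := @near_eq0_dX (phi \o @swap_pt R) (swap_pt p).
  by exists e => // z z1 z2; apply: h.
by exists d => // z z1 z2; rewrite dY_swap; apply: hd.
Qed.

Lemma flat_near_eq0 p (Up : U p) f : near_eq p (hval f) (fun=> 0) -> flat holo_der (evat Up) f.
Proof.
move=> h n; elim: n f h => [|n IH] f h; have f0 : hval f p = 0.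
- by case: h => e e0; apply; rewrite subrr normr0.
- by split.
- by case: h => e e0; apply; rewrite subrr normr0.
have [e e0 he] := (proj1 (CC_open U) (@ropen _ D)) p Up.
have key phi g : near_eq p phi (fun=> 0) -> (forall z, U z -> hval g z = phi z) ->
    near_eq p (hval g) (fun=> 0).
  case=> d d0 hd hg; have [t [t0 te td]] := min_pos e0 d0.
  exists t => // z z1 z2; rewrite hg; first by apply: hd; [apply: lt_le_trans z1 td | apply: lt_le_trans z2 td].
  by apply: he; [apply: lt_le_trans z1 te | apply: lt_le_trans z2 te].
split; first exact: f0.
split; apply: IH.
  by apply: (key _ _ (near_eq0_dX h)) => z Uz; exact: hdxE.
by apply: (key _ _ (near_eq0_dY h)) => z Uz; exact: hdyE.
Qed.

(** The Taylor coefficients vanish by induction on the total degree: up to a nonzero integer factor,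
    one of degree [n + 1] is a coefficient of degree [n] of [dx f] or [dy f]. *)
Lemma near_eq0_flat p (Up : U p) f : flat holo_der (evat Up) f -> near_eq p (hval f) (fun=> 0).
Proof.
move=> hf; have [rho [M [a h]]] := hval_an f Up; apply: (near_eq0_of_coef h).
have tr phi (g : O) r N b : (forall z, U z -> hval g z = phi z) -> pser p r N b phi ->
    exists r', pser p r' N b (hval g).
  move=> hg hb; have [e e0 he] := near_eq_region Up hg.
  have [t [t0 te tr]] : exists t, [/\ 0 < t, t <= e & t <= r].
    by case: hb => r0 _ _ _; exact: min_pos.
  exists t; apply: (pser_shrink t0 tr _ hb) => z z1 z2; apply/esym/he.
    by apply: le_lt_trans z1 _; apply: lt_le_trans (half_lt t0) te.
  by apply: le_lt_trans z2 _; apply: lt_le_trans (half_lt t0) te.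
suff key n : forall g r N b, vanishes holo_der (evat Up) n g -> pser p r N b (hval g) ->
    forall i j, (i + j <= n)%N -> b i j = 0.
  by move=> i j; exact: (key (i + j)%N f rho M a (hf _) h).
elim: n {f rho M a h hf} => [|n IH] g r N b.
  case=> g0 _ /pser_center gb i j; rewrite leqn0 addn_eq0 => /andP[/eqP -> /eqP ->].
  by rewrite -gb.
case=> g0 [gx gy] hb [|i] [|j] l.
- by rewrite -(pser_center hb).
- have [s hs] := tr _ (hdy g) _ _ _ (fun z Uz => hdyE g Uz) (pser_dY hb).
  have /eqP := IH _ _ _ _ gy hs 0%N j l.
  by rewrite /dcoefY /transpose_coef /dcoef mulrn_eq0 => /eqP.
- have [s hs] := tr _ (hdx g) _ _ _ (fun z Uz => hdxE g Uz) (pser_dX hb).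
  have /eqP := IH _ _ _ _ gx hs i 0%N l.
  by rewrite /dcoef mulrn_eq0 => /eqP.
- have [s hs] := tr _ (hdx g) _ _ _ (fun z Uz => hdxE g Uz) (pser_dX hb).
  have /eqP := IH _ _ _ _ gx hs i j.+1 l.
  by rewrite /dcoef mulrn_eq0 => /eqP.
Qed.
End HoloRing.

(** * Action of symbols on analytic functions *)

Section HoloAction.
Variables (R : realType) (D W : region R).
Hypothesis WD : rset W `<=` rset D.
Local Notation K := (CC R).
Local Notation K2 := (C2 R).

(** Coefficients live on [D] and arguments on a smaller [W]: the operators are given on all of [D],
    but the relation is only obtained near the base point. *)
Definition restr_scale (f : holo D) (g : holo W) : holo W := to_holo W (hval f \* hval g).
Lemma restr_scaleE f g z : rset W z -> hval (restr_scale f g) z = hval f z * hval g z.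
Proof.
move=> Wz; rewrite to_holoE // => p Wp; apply: analytic_mul; last exact: hval_an.
exact/hval_an/WD.
Qed.
Lemma restr_scaleDl f f' g : restr_scale (f + f') g = restr_scale f g + restr_scale f' g.
Proof. by apply: holo_eq => z Wz; rewrite hvalD !restr_scaleE // hvalD mulrDl. Qed.
Lemma restr_scaleDr f g g' : restr_scale f (g + g') = restr_scale f g + restr_scale f g'.
Proof. by apply: holo_eq => z Wz; rewrite hvalD !restr_scaleE // hvalD mulrDr. Qed.
Lemma restr_scaleA f f' g : restr_scale (f * f') g = restr_scale f (restr_scale f' g).
Proof. by apply: holo_eq => z Wz; rewrite !restr_scaleE // hvalM mulrA. Qed.

Lemma restr_scale_dx f g : hdx (restr_scale f g) = restr_scale (hdx f) g + restr_scale f (hdx g).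
Proof.
apply: holo_eq => z Wz; rewrite hvalD !restr_scaleE //.
have e : dX (hval f \* hval g) z = dX (hval (restr_scale f g)) z.
  by apply: hdx_near => // w Ww; exact: restr_scaleE.
apply: (etrans (hdxE (restr_scale f g) Wz)); apply: (etrans (esym e)).
rewrite dX_mul; [|exact/hval_an/WD|exact: hval_an].
by rewrite (hdxE f (WD Wz)) (hdxE g Wz).
Qed.
Lemma restr_scale_dy f g : hdy (restr_scale f g) = restr_scale (hdy f) g + restr_scale f (hdy g).
Proof.
apply: holo_eq => z Wz; rewrite hvalD !restr_scaleE //.
have e : dY (hval f \* hval g) z = dY (hval (restr_scale f g)) z.
  by apply: hdy_near => // w Ww; exact: restr_scaleE.
apply: (etrans (hdyE (restr_scale f g) Wz)); apply: (etrans (esym e)).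
rewrite dY_mul; [|exact/hval_an/WD|exact: hval_an].
by rewrite (hdyE f (WD Wz)) (hdyE g Wz).
Qed.

Definition hact (q : symb (holo_der D)) (g : holo W) : holo W :=
  pact restr_scale (bdx (holo_der W)) (bdy (holo_der W)) q g.

Lemma hactM p q g : hact (p * q) g = hact p (hact q g).
Proof.
exact: (@pact_smul _ (holo_der D) _ restr_scale (bdx (holo_der W)) (bdy (holo_der W)) restr_scaleDl restr_scaleDr restr_scaleA restr_scale_dx restr_scale_dy (@hdxyC R W)).
Qed.
Lemma hactDl p q g : hact (p + q) g = hact p g + hact q g.
Proof. exact: (pactDl _ _ restr_scaleDl). Qed.
Lemma hactBl p q g : hact (p - q) g = hact p g - hact q g.
Proof. by apply/eqP; rewrite eq_sym subr_eq -hactDl subrK. Qed.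
Lemma hact_suml I r (P : pred I) (F : I -> symb (holo_der D)) g :
  hact (\sum_(i <- r | P i) F i) g = \sum_(i <- r | P i) hact (F i) g.
Proof. exact: (pact_suml _ _ restr_scaleDl). Qed.
Lemma hact1 g : hact 1 g = g.
Proof.
have b : bound 1 (1 : symb (holo_der D)) by move=> [|i] [|j] // _; rewrite co_mono.
rewrite /hact (pactE _ _ restr_scaleDl _ b) !big_ord1 co_mono /=.
by apply: holo_eq => z Wz; rewrite restr_scaleE // hval1 ?mul1r //; exact: WD.
Qed.
Lemma hact_exp p n g : hact (p ^+ n) g = iter n (hact p) g.
Proof. by elim: n => [|n IH]; rewrite ?hact1 // exprS hactM IH. Qed.
Lemma hact_scal f p g : hact (scal f p) g = restr_scale f (hact p g).
Proof. exact: (pact_scal _ _ restr_scaleDl restr_scaleDr restr_scaleA). Qed.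

(** The bridge between raw functions, arbitrary outside [W], and ring elements, which are 0
    there. *)
Definition agree (f : K2 -> K) (g : holo W) := forall z, rset W z -> f z = hval g z.

Lemma agree_analytic f g : agree f g -> analytic_on (rset W) f.
Proof.
move=> fg; apply/analytic_onP => p Wp; apply: (near_eq_analytic (hval_an g Wp)).
by apply: near_eq_region Wp _ => z Wz; rewrite fg.
Qed.
Lemma agree_to_holo f : analytic_on (rset W) f -> agree f (to_holo W f).
Proof. by move=> /analytic_onP hf z Wz; rewrite to_holoE. Qed.
Lemma agree_dX f g : agree f g -> agree (dX f) (hdx g).
Proof.
move=> fg z Wz; apply: (etrans _ (esym (hdxE g Wz))).
by apply: hdx_near => // w Ww; rewrite fg.
Qed.
Lemma agree_dY f g : agree f g -> agree (dY f) (hdy g).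
Proof.
move=> fg z Wz; apply: (etrans _ (esym (hdyE g Wz))).
by apply: hdy_near => // w Ww; rewrite fg.
Qed.
Lemma agree_iter i j f g : agree f g ->
  agree (iter i (@dX R) (iter j (@dY R) f)) (iter i (@hdx R W) (iter j (@hdy R W) g)).
Proof.
move=> fg; elim: i => [|i IH]; last exact: agree_dX.
by elim: j => [|j IH] //; exact: agree_dY.
Qed.

Definition diffop_symb (L : diffop R) : symb (holo_der D) :=
  symb_of_coef _ (ord L).+1 (fun i j => to_holo D (coef L i j)).

Lemma hactE N q g z : bound N q -> rset W z -> hval (hact q g) z =
  \sum_(i < N) \sum_(j < N) hval (co q i j) z * hval (iter i (@hdx R W) (iter j (@hdy R W) g)) z.
Proof.
move=> b Wz; rewrite /hact (pactE _ _ restr_scaleDl _ b) hval_sum; apply: eq_bigr => i _.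
by rewrite hval_sum; apply: eq_bigr => j _; rewrite restr_scaleE.
Qed.

Lemma agree_act L f g : diffop_on (rset D) L -> agree f g -> agree (act L f) (hact (diffop_symb L) g).
Proof.
move=> hL fg z Wz; have b : bound (ord L).+1 (diffop_symb L).
  by move=> i j; rewrite co_symb_of_coef !ltnS => /orP[]; rewrite ltnNge => /negPf ->; rewrite ?andbF.
rewrite (hactE _ b Wz); apply: eq_bigr => i _; apply: eq_bigr => j _.
rewrite (agree_iter i j fg Wz) co_symb_of_coef !ltn_ord to_holoE //; last exact: WD.
by apply/analytic_onP; apply: hL; rewrite -ltnS.
Qed.
End HoloAction.

(** * Faithfulness of the action of symbols *)

Section Faithful.
Variables (R : realType) (D : region R).
Local Notation K := (CC R).
Local Notation O := (holo D).

Lemma iter_derivation_exp (A : comNzRingType) (dx : A -> A) (x c : A) n a :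
  (forall f g, dx (f + g) = dx f + dx g) -> (forall f g, dx (f * g) = dx f * g + f * dx g) ->
  dx x = 1 -> dx c = 0 -> iter a dx (x ^+ n * c) = (x ^+ (n - a) *+ n ^_ a) * c.
Proof.
move=> dD dM dx1 dc0.
have d1 : dx 1 = 0 by apply: (addrI (dx 1)); have := dM 1 1; rewrite !mulr1 mul1r addr0.
have d0 : dx 0 = 0 by apply: (addrI (dx 0)); rewrite -dD !addr0.
have dn f m : dx (f *+ m) = dx f *+ m by elim: m => [|m IH]; rewrite ?mulr0n // !mulrS dD IH.
have dexp m : dx (x ^+ m) = x ^+ m.-1 *+ m.
  elim: m => [|m IH]; first by rewrite expr0.
  rewrite exprS dM dx1 mul1r IH; case: m {IH} => [|m]; first by rewrite mulr0n mulr0 addr0.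
  by rewrite mulrnAr -exprS -mulrS.
elim: a => [|a IH]; first by rewrite subn0 ffactn0 mulr1n.
rewrite iterS IH dM dc0 mulr0 addr0 dn dexp -mulrnA subnS ffactnSr mulnC.
by [].
Qed.

Lemma coord_an1 (z p : C2 R) : analytic_at p (fun w => w.1 - z.1).
Proof.
have h : analytic_at p ((fun w => w.1 - p.1) \+ (fun=> p.1 - z.1)).
  by apply: analytic_add; [do 3!eexists; exact: pser_fst | exact: analytic_cst].
apply: (near_eq_analytic h); exists 1 => // w _ _ /=; by rewrite addrA subrK.
Qed.
Lemma coord_an2 (z p : C2 R) : analytic_at p (fun w => w.2 - z.2).
Proof.
have h : analytic_at p ((fun w => w.2 - p.2) \+ (fun=> p.2 - z.2)).
  by apply: analytic_add; [do 3!eexists; exact: pser_snd | exact: analytic_cst].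
apply: (near_eq_analytic h); exists 1 => // w _ _ /=; by rewrite addrA subrK.
Qed.

Lemma dX_coord1 (z p : C2 R) : dX (fun w : C2 R => w.1 - z.1) p = 1.
Proof.
apply: (@dX_cvg R _ p 1 0 1) => // h _ _ /=.
have -> : p.1 + h - z.1 - (p.1 - z.1) - h * 1 = 0 by ring.
by rewrite normr0 mul0r.
Qed.
Lemma dX_coord2 (z p : C2 R) : dX (fun w : C2 R => w.2 - z.2) p = 0.
Proof.
apply: (@dX_cvg R _ p 0 0 1) => // h _ _ /=.
by rewrite subrr mulr0 subr0 normr0 mul0r.
Qed.
Lemma dY_coord1 (z p : C2 R) : dY (fun w : C2 R => w.1 - z.1) p = 0.
Proof. rewrite dY_swap; exact: (dX_coord2 (swap_pt z)). Qed.
Lemma dY_coord2 (z p : C2 R) : dY (fun w : C2 R => w.2 - z.2) p = 1.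
Proof. rewrite dY_swap; exact: (dX_coord1 (swap_pt z)). Qed.

(** Applied to [(x - z1)^i (y - z2)^j] and evaluated at [z], the operator returns [i! j!] times its
    coefficient at [(i, j)]. This turns the hypotheses on the action into identities of symbols. *)
Lemma hact_faithful (q : symb (holo_der D)) :
  (forall g : O, hact q g = 0) -> q = 0.
Proof.
move=> hq; apply: coP => i j; rewrite co0; apply: holo_eq => z Uz; rewrite hval0.
pose X : O := to_holo D (fun w => w.1 - z.1); pose Y : O := to_holo D (fun w => w.2 - z.2).
have XE w : rset D w -> hval X w = w.1 - z.1 by move=> Uw; rewrite to_holoE // => p _; exact: coord_an1.
have YE w : rset D w -> hval Y w = w.2 - z.2 by move=> Uw; rewrite to_holoE // => p _; exact: coord_an2.
have Xx : hdx X = 1.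
  apply: holo_eq => w Uw; rewrite (hdxE X Uw) hval1 // -(dX_coord1 z w).
  by apply/esym/hdx_near => // v Uv; rewrite XE.
have Xy : hdy X = 0.
  apply: holo_eq => w Uw; rewrite (hdyE X Uw) hval0 -(dY_coord1 z w).
  by apply/esym/hdy_near => // v Uv; rewrite XE.
have Yx : hdx Y = 0.
  apply: holo_eq => w Uw; rewrite (hdxE Y Uw) hval0 -(dX_coord2 z w).
  by apply/esym/hdx_near => // v Uv; rewrite YE.
have Yy : hdy Y = 1.
  apply: holo_eq => w Uw; rewrite (hdyE Y Uw) hval1 // -(dY_coord2 z w).
  by apply/esym/hdy_near => // v Uv; rewrite YE.
have dexp0 (dx : O -> O) (f : O) n : (forall f g, dx (f * g) = dx f * g + f * dx g) ->
    dx f = 0 -> dx 1 = 0 -> dx (f ^+ n) = 0.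
  by move=> dM f0 d1; elim: n => [|n IH]; rewrite ?expr0 // exprS dM f0 IH mul0r mulr0 addr0.
have d1x : hdx (1 : O) = 0 by exact: hdx_cst.
have d1y : hdy (1 : O) = 0 by exact: hdy_cst.
have der a b : iter a (@hdx R D) (iter b (@hdy R D) (Y ^+ j * X ^+ i)) =
    (X ^+ (i - a) *+ i ^_ a) * (Y ^+ (j - b) *+ j ^_ b).
  rewrite (iter_derivation_exp _ _ (@hdyD R D) (@hdyM R D) Yy); last exact: (dexp0 _ _ _ (@hdyM R D)).
  rewrite mulrC (iter_derivation_exp _ _ (@hdxD R D) (@hdxM R D) Xx) //.
  by rewrite raddfMn /= (dexp0 _ _ _ (@hdxM R D)) // mul0rn.
have ev_mulrn (f : O) n : hval (f *+ n) z = hval f z *+ n.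
  by elim: n => [|n IH]; rewrite ?mulr0n ?hval0 // !mulrS hvalD IH.
have ev_exp (f : O) n : hval (f ^+ n) z = hval f z ^+ n.
  by elim: n => [|n IH]; rewrite ?expr0 ?hval1 // !exprS hvalM IH.
have val a b : hval (iter a (@hdx R D) (iter b (@hdy R D) (Y ^+ j * X ^+ i))) z =
    if (a == i) && (b == j) then (i`!)%:R * (j`!)%:R else 0.
  rewrite der hvalM !ev_mulrn !ev_exp XE // YE // !subrr !expr0n !subn_eq0.
  (* Truncated subtraction gives [0 ^+ (m - n) = 1] for every [n >= m]; the falling factorial
     removes [n > m]. *)
  have aux m n : ((m <= n)%N%:R : K) *+ m ^_ n = if n == m then (m`!)%:R else 0.
    case: ltngtP => [l|l|->]; last by rewrite ffactnn.
      by rewrite ffact_small // mulr0n.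
    by rewrite mul0rn.
  by rewrite !aux; case: eqP => _; case: eqP => _; rewrite ?mulr0 ?mul0r.
have [N b] := bound_exists q.
have := congr1 (fun f => hval f z) (hq (Y ^+ j * X ^+ i)).
rewrite (hactE (fun _ h => h) _ b Uz) hval0.
rewrite (sum_only (n := i) (F := fun a => \sum_(b < N) hval (co q a b) z *
   hval (iter a (@hdx R D) (iter b (@hdy R D) (Y ^+ j * X ^+ i))) z)).
- rewrite (sum_only (n := j) (F := fun b => hval (co q i b) z *
    hval (iter i (@hdx R D) (iter b (@hdy R D) (Y ^+ j * X ^+ i))) z)).
  + rewrite val !eqxx /= => /eqP; rewrite !mulf_eq0 !pnatr_eq0.
    by rewrite !eqn0Ngt !fact_gt0 !orbF => /eqP.
  + by move=> c /negPf ne; rewrite val ne andbF mulr0.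
  + by move=> l; rewrite b ?l ?orbT // hval0 mul0r.
- by move=> a /negPf ne; rewrite big1 // => c _; rewrite val ne mulr0.
- by move=> l; rewrite big1 // => c _; rewrite b ?l // hval0 mul0r.
Qed.
End Faithful.

(** * Choice of the base point and of the final region *)

Section Assembly.
Variables (R : realType) (D : region R).
Local Notation K := (CC R).
Local Notation K2 := (C2 R).
Local Notation U := (rset D).
Local Notation O := (holo D).

Lemma to_holo_hval (f : O) : to_holo D (hval f) = f.
Proof. by apply: holo_eq => z Uz; rewrite to_holoE // => p Up; exact: hval_an. Qed.

Lemma symb_comm_eq (L1 L2 P H : diffop R) :
  diffop_on U L1 -> diffop_on U L2 -> diffop_on U P -> diffop_on U H ->
  op_eq U (op_comm (act L1) (act L2)) (op_comp (act P) (act H)) ->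
  comm (diffop_symb D L1) (diffop_symb D L2) = diffop_symb D P * diffop_symb D H.
Proof.
move=> h1 h2 hP hH eq; apply/eqP; rewrite -subr_eq0; apply/eqP; apply: hact_faithful => g.
have UU : U `<=` U by [].
have ag : agree (hval g) g by [].
have a12 := agree_act UU h1 (agree_act UU h2 ag).
have a21 := agree_act UU h2 (agree_act UU h1 ag).
have aPH := agree_act UU hP (agree_act UU hH ag).
apply: holo_eq => z Uz; rewrite (hactBl UU) (hactBl UU) !(hactM UU) !hvalB hval0.
have e := eq _ (agree_analytic ag) z Uz; rewrite /op_comm /op_comp in e.
by rewrite -(a12 z Uz) -(a21 z Uz) -(aPH z Uz) e subrr.
Qed.

Lemma diffop_on_Hop u : analytic_on U u -> diffop_on U (Hop u).
Proof.
move=> hu i j _ _ /=; apply/analytic_onP => p Up.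
case: ifP => _; first exact: analytic_cst.
by case: ifP => _; [move/analytic_onP: hu; exact | exact: analytic_cst].
Qed.

Lemma diffop_symb_Hop u : diffop_symb D (Hop u) = hsymb (holo_der D) (to_holo D u).
Proof.
have m1 : to_holo D (fun=> -1) = -1.
  by apply: holo_eq => z Uz; rewrite to_holoE ?hvalN ?hval1 // => p _; exact: analytic_cst.
have m0 : to_holo D (fun=> 0) = 0 by [].
apply: coP => i j; rewrite co_symb_of_coef coD !co_mono.
by case: i => [|[|i]]; case: j => [|[|j]]; rewrite /= ?andbF ?m1 ?m0 ?addr0 ?add0r.
Qed.

Lemma top_nonzero (V : set K2) N (F G : nat -> K2 -> K) :
  (forall i z, (N <= i)%N -> V z -> F i z = 0 /\ G i z = 0) ->
  (forall i z, (0 < i)%N -> V z -> F i z = 0 /\ G i z = 0) \/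
  exists n, (forall i z, (n.+1 < i)%N -> V z -> F i z = 0 /\ G i z = 0) /\
    exists2 z, V z & (F n.+1 z != 0) || (G n.+1 z != 0).
Proof.
elim: N => [|N IH] h; first by left=> i z _; exact: h.
case: N IH h => [|N] IH h; first by left=> i z; exact: h.
have [[z Vz hz]|no] := pselect (exists2 z, V z & (F N.+1 z != 0) || (G N.+1 z != 0)).
  by right; exists N; split; [move=> i w l; exact: h | exists z].
apply: IH => i z; rewrite leq_eqVlt => /orP[/eqP <- Vz|]; last exact: h.
apply: contrapT => hz; apply: no; exists z => //; rewrite -negb_and; apply/negP => /andP[/eqP a /eqP b].
exact: hz.
Qed.

Lemma near_eq0_in (V : set K2) p phi : open V -> V p -> (forall z, V z -> phi z = 0) ->
  near_eq p phi (fun=> 0).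
Proof.
move=> /CC_open oV Vp h; have [e e0 he] := oV p Vp.
by exists e => // z z1 z2; apply: h; exact: he.
Qed.

(** The top index is taken over all of [V], so higher coefficients vanish on [V] and are flat at
    each of its points; the locus where a top coefficient is nonzero is open. [d] is abstract in
    order to serve both variables. *)
Lemma generic_region (d : biderivation O) (V : set K2) (p q : symb d) :
  (forall z (Uz : U z) f, near_eq z (hval f) (fun=> 0) -> flat d (evat Uz) f) ->
  open V -> V !=set0 -> V `<=` U -> reduced p -> reduced q ->
  exists V', [/\ open V', V' !=set0, V' `<=` V &
    forall z (Uz : U z), V' z -> generic (evat Uz) p q].
Proof.
move=> hflat oV V0 VU rp rq; have [N1 b1] := bound_exists p; have [N2 b2] := bound_exists q.
pose F i z := hval (co p i 0) z; pose G i z := hval (co q i 0) z.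
have hN i z : (maxn N1 N2 <= i)%N -> V z -> F i z = 0 /\ G i z = 0.
  by rewrite geq_max => /andP[l1 l2] _; rewrite /F /G b1 ?b2 ?l1 ?l2 // hval0.
have zero n (t : symb d) z (Uz : U z) : reduced t -> V z ->
    (forall i w, (n < i)%N -> V w -> hval (co t i 0) w = 0) -> flat_degX_le (evat Uz) n t.
  move=> rt Vz h [|i] [|j] // l; last by rewrite rt; exact: flat0.
  apply: hflat; apply: (near_eq0_in oV Vz) => w; exact: h.
have [h|[n [h [z Vz hz]]]] := top_nonzero hN.
  exists V; split=> // z Uz Vz; left.
  by split; apply: zero => // i w l Vw; have [] := h i w l Vw.
exists [set w | V w /\ (F n.+1 w != 0) || (G n.+1 w != 0)]; split.
- apply/CC_open => w [Vw hw]; have [e e0 he] := (proj1 (CC_open V) oV) w Vw.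
  have key (f : O) : hval f w != 0 -> exists2 c : K, 0 < c & forall v,
      `|v.1 - w.1| < c -> `|v.2 - w.2| < c -> V v /\ hval f v != 0.
    move=> fw; have [c c0 hc] := nonzero_near (hval_an f (VU _ Vw)) fw.
    have [t [t0 te td]] := min_pos e0 c0.
    exists t => // v v1 v2; split.
      by apply: he; [apply: lt_le_trans v1 te | apply: lt_le_trans v2 te].
    by apply: hc; [apply: lt_le_trans v1 td | apply: lt_le_trans v2 td].
  by case/orP: hw => /key [c c0 hc]; exists c => // v v1 v2; have [Vv nz] := hc v v1 v2; split=> //; apply/orP; [left | right].
- by exists z.
- by move=> w [].
- move=> w Uw [Vw hw]; right; exists n; split=> //.
    by apply: zero => // i v l Vv; have [] := h i v l Vv.
  by apply: zero => // i v l Vv; have [] := h i v l Vv.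
Qed.

(** Genericity in X holds at every point of an open set, so it survives the further shrinking that
    yields genericity in Y. *)
Lemma generic_point (p q : symb (holo_der D)) : reduced p -> reduced q ->
  exists z (Uz : U z), generic (evat Uz) p q /\ generic (evat Uz) (swap_symb p) (swap_symb q).
Proof.
move=> rp rq.
have [V [oV V0 VU hV]] := generic_region (@flat_near_eq0 R D) (@ropen _ D)
  (ex_intro _ _ (@rpt_in _ D)) (fun _ h => h) rp rq.
have fl z (Uz : U z) f : near_eq z (hval f) (fun=> 0) ->
    flat (biderivation_swap (holo_der D)) (evat Uz) f.
  by move=> h n; apply: vanishes_swap_symb; exact: flat_near_eq0.
have [V' [_ [z Vz] V'V hV']] := generic_region fl oV V0 VU (swap_symb_reduced rp) (swap_symb_reduced rq).
have Uz := VU _ (V'V _ Vz).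
by exists z, Uz; split; [exact/hV/V'V | exact: hV'].
Qed.

Lemma common_radius N (P : nat -> K -> Prop) :
  (forall i r s, s <= r -> P i r -> P i s) ->
  (forall i, exists2 r, 0 < r & P i r) ->
  exists2 r, 0 < r & forall i, (i < N)%N -> P i r.
Proof.
move=> mono h; elim: N => [|N [r r0 hr]]; first by exists 1.
have [s s0 hs] := h N; have [t [t0 tr ts]] := min_pos r0 s0.
exists t => // i; rewrite ltnS leq_eqVlt => /orP[/eqP ->|l]; first exact: mono hs.
exact: mono (hr i l).
Qed.

(** Each flat coefficient vanishes near [p] and finitely many can be nonzero, so one radius serves
    all. The region is the interior of the common zero set. *)
Lemma vanishing_region p (Up : U p) (e : symb (holo_der D)) : flatc (evat Up) e ->
  exists W : region R, rset W `<=` U /\ forall i j z, rset W z -> hval (co e i j) z = 0.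
Proof.
move=> fe; have [N b] := bound_exists e.
have [eps eps0 heps] := (proj1 (CC_open U) (@ropen _ D)) p Up.
pose P i j r := forall z, `|z.1 - p.1| < r -> `|z.2 - p.2| < r -> hval (co e i j) z = 0.
have mono i j r s : s <= r -> P i j r -> P i j s.
  by move=> sr h z z1 z2; apply: h; [apply: lt_le_trans z1 sr | apply: lt_le_trans z2 sr].
have [r r0 hr] : exists2 r, 0 < r & forall i, (i < N)%N -> forall j, (j < N)%N -> P i j r.
  apply: (@common_radius N (fun i r => forall j, (j < N)%N -> P i j r)).
    by move=> i r s sr h j l; apply: mono sr (h j l).
  by move=> i; apply: common_radius (mono i) _ => j; exact: near_eq0_flat.
have [t [t0 te tr]] := min_pos eps0 r0.
pose Z := [set z | U z /\ forall i j, hval (co e i j) z = 0].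
have Zp : Z^° p.
  apply/nbhs_ballP; exists t => // z [z1 z2].
  have {}z1 : `|z.1 - p.1| < t by rewrite distrC -CC_ballE.
  have {}z2 : `|z.2 - p.2| < t by rewrite distrC -CC_ballE.
  split; first by apply: heps; [apply: lt_le_trans z1 te | apply: lt_le_trans z2 te].
  move=> i j; case: (ltnP i N) => [li|li]; last by rewrite b ?li // hval0.
  case: (ltnP j N) => [lj|lj]; last by rewrite b ?lj ?orbT // hval0.
  by apply: (hr i li j lj); [apply: lt_le_trans z1 tr | apply: lt_le_trans z2 tr].
exists (Region Zp (@open_interior _ Z)); split => /=.
  by move=> z /interior_subset [].
by move=> i j z /interior_subset [].
Qed.
End Assembly.

(** * The polynomial Q and the conclusion *)

Section Polynomial.
Variables (R : realType).
Local Notation K := (CC R).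
Local Notation K2 := (C2 R).

Lemma sum_size_widen (T : nzSemiRingType) (p : {poly T}) N (V : nmodType) (F : nat -> V) :
  (size p <= N)%N -> (forall i, p`_i = 0 -> F i = 0) ->
  \sum_(i < size p) F i = \sum_(i < N) F i.
Proof.
move=> le h; rewrite (big_ord_widen _ F le) big_mkcond; apply: eq_bigr => i _.
by case: ltnP => // l; rewrite h // nth_default.
Qed.

(** [b] is defined on ordinals only; [insub] extends it by 0 to the naturals that [\poly] ranges
    over. *)
Definition combination_poly N (b : 'I_N -> 'I_N -> K) : {poly {poly K}} :=
  \poly_(r < N) \poly_(s < N) oapp (fun r' => oapp (b r') 0 (insub s)) 0 (insub r).

Lemma coef_combination_poly N (b : 'I_N -> 'I_N -> K) (r s : 'I_N) : (combination_poly b)`_r`_s = b r s.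
Proof. by rewrite coef_poly ltn_ord coef_poly ltn_ord !valK. Qed.

Lemma poly_act_combination N (b : 'I_N -> 'I_N -> K) (A B : (K2 -> K) -> K2 -> K) f z :
  poly_act (combination_poly b) A B f z = \sum_(r < N) \sum_(s < N) b r s * iter r A (iter s B f) z.
Proof.
set Q := combination_poly b.
rewrite /poly_act (@sum_size_widen _ Q N _
  (fun r => \sum_(s < size Q`_r) (Q`_r)`_s * iter r A (iter s B f) z)).
- apply: eq_bigr => r _; rewrite (@sum_size_widen _ Q`_r N _
    (fun s => (Q`_r)`_s * iter r A (iter s B f) z)).
  + by apply: eq_bigr => s _; rewrite coef_combination_poly.
  + by rewrite coef_poly ltn_ord; exact: size_poly.
  + by move=> s ->; rewrite mul0r.
- exact: size_poly.
- by move=> r ->; rewrite size_poly0 big_ord0.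
Qed.
End Polynomial.

Theorem theorem7 (R : realType) (U : set (C2 R)) (u : C2 R -> CC R)
  (L1 L2 P0 P1 P2 : diffop R) :
  open U -> U !=set0 ->
  analytic_on U u ->
  diffop_on U L1 -> diffop_on U L2 ->
  diffop_on U P0 -> diffop_on U P1 -> diffop_on U P2 ->
  op_eq U (op_comm (act L1) (act L2)) (op_comp (act P0) (act (Hop u))) ->
  op_eq U (op_comm (act L1) (act (Hop u))) (op_comp (act P1) (act (Hop u))) ->
  op_eq U (op_comm (act L2) (act (Hop u))) (op_comp (act P2) (act (Hop u))) ->
  exists Q : {poly {poly CC R}}, Q != 0 /\
    exists W : set (C2 R), [/\ open W, W !=set0 & W `<=` U] /\
      exists S : diffop R, diffop_on W S /\
        op_eq W (poly_act Q (act L1) (act L2)) (op_comp (act S) (act (Hop u))).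
Proof.
move=> oU [p0 Up0] hu hL1 hL2 hP0 hP1 hP2 e0 e1 e2.
pose D := Region Up0 oU; pose u' : holo D := to_holo D u.
have hH := @diffop_on_Hop R D u hu.
have HE := diffop_symb_Hop D u.
pose l1 := diffop_symb D L1; pose l2 := diffop_symb D L2.
have n0 : in_ideal u' (comm l1 l2).
  by exists (diffop_symb D P0); rewrite -HE; exact: symb_comm_eq.
have n1 : normal u' l1.
  by exists (diffop_symb D P1); rewrite -HE; exact: symb_comm_eq.
have n2 : normal u' l2.
  by exists (diffop_symb D P2); rewrite -HE; exact: symb_comm_eq.
have [N1 b1] := bound_exists l1; have [N2 b2] := bound_exists l2.
have [r1 [rr1 _ J1]] := reduction u' b1; have [r2 [rr2 _ J2]] := reduction u' b2.
have [p [Up [gx gy]]] := generic_point rr1 rr2.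
have [N [b [e [[r [s brs]] fe [t ht]]]]] :=
  @algebraic_relation (holo D) (holo_der D) (CC R) (evat Up) (hcst D) u' (@hdx_cst R D) (@hdy_cst R D)
    (fun c => hcstE c Up) _ _ _ _ n1 n2 n0 rr1 rr2 J1 J2 gx gy.
have [W [WU We]] := vanishing_region fe.
exists (combination_poly b); split.
  by apply: contraNneq brs => Q0; rewrite -coef_combination_poly Q0 !coef0.
exists (rset W); split; first by split; [exact: ropen | exists (rpt W); exact: rpt_in | exact: WU].
have [Nt bt] := bound_exists t.
(* An order of [Nt] includes one row and one column beyond the bound on [t]; they are zero. *)
pose S := DiffOp Nt (fun i j => hval (co t i j)).
have hS : diffop_on U S by move=> i j _ _; apply/analytic_onP => q Uq; exact: hval_an.
have SE : diffop_symb D S = t.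
  apply: coP => i j; rewrite co_symb_of_coef /= to_holo_hval; case: ifP => // /negbT.
  by rewrite negb_and -!leqNgt => /orP[l|l]; rewrite bt // (ltnW l) ?orbT.
exists S; split.
  by move=> i j _ _; apply/analytic_onP => q Wq; apply: hval_an; exact: WU.
move=> f hf z Wz; pose g := to_holo W f.
have ag : agree f g by exact: agree_to_holo.
have it L m h k : diffop_on U L -> agree h k ->
    agree (iter m (act L) h) (iter m (@hact R D W (diffop_symb D L)) k).
  by move=> hL hk; elim: m => //= m IH; exact: (agree_act WU hL IH).
rewrite poly_act_combination.
have -> : \sum_(r < N) \sum_(s < N) b r s * iter r (act L1) (iter s (act L2) f) z =
    hval (hact (combination (hcst D) b l1 l2) g) z.
  rewrite (hact_suml WU) hval_sum; apply: eq_bigr => i _.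
  rewrite (hact_suml WU) hval_sum; apply: eq_bigr => j _.
  rewrite (hact_scal WU) (restr_scaleE WU _ _ Wz) hcstE; last exact: WU.
  by rewrite (hactM WU) !(hact_exp WU) -(it _ _ _ _ hL1 (it _ _ _ _ hL2 ag) z Wz).
(* The combination is [t H + e], and [e] acts as zero on [W], where all its coefficients vanish. *)
rewrite -[combination _ _ _ _](subrK e) ht (hactDl WU) hvalD.
have [Ne be] := bound_exists e.
rewrite [X in _ + X](hactE WU _ be Wz) [X in _ + X]big1 ?addr0; last first.
  by move=> i _; rewrite big1 // => j _; rewrite We // mul0r.
rewrite (hactM WU) -HE -SE.
by rewrite -(agree_act WU hS (agree_act WU hH ag) Wz).
Qed.
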